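(* Let $n \geq 2k$ and let $Y$ be a Cameron-Liebler class of $k$-spaces in $\mathbb{F}_q^n$ of size $s \begin{bmatrix} n-1 \\ k-1 \end{bmatrix}_q$. If $16 s \leq \min\{ q^{\frac{n-k-\ell+2}{3}}, q^{\frac{n-2k-\tilde{r}+1}{3}} \}$, where $n = \tilde{m} k - \tilde{r}$ with $0 \leq \tilde{r} < k$, then $s \leq 2$ and $Y$ is trivial.
   Context: Here $q$ is a prime power, $[a] = [a]_q = \frac{q^a-1}{q-1}$, and $\begin{bmatrix} a \\ b \end{bmatrix}_q = \prod_{i=0}^{b-1} \frac{[a-i]_q}{[b-i]_q}$ is the Gaussian ($q$-binomial) coefficient (equal to $0$ if $b<0$); $\begin{bmatrix} n-1 \\ k-1 \end{bmatrix}_q$ is the number of $k$-spaces of $\mathbb{F}_q^n$ through a fixed $1$-space. A Cameron-Liebler class of $k$-spaces in $\mathbb{F}_q^n$ is a Boolean degree $1$ function on the $k$-spaces of $\mathbb{F}_q^n$ (when $k \mid n$, such a family meets every spread of $k$-spaces in the same number $s$ of elements). The integer $\ell$ is defined by $[\ell-1] < s \leq [\ell]$. A Cameron-Liebler class is called trivial if, up to taking complements, it is empty, the set of all $k$-spaces through a fixed point, the set of all $k$-spaces in a fixed hyperplane, or the disjoint union of the latter two (point not in the hyperplane).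
   Formalization: The formal theorem assumes k ≥ 2: for k = 1 every set of points is a Boolean degree 1 function, and n = 2, k = 1, Y three points, s = 3, ℓ = 2, q ≥ 48³ satisfies all hypotheses although s > 2. *)

(* Defs.v *)
From HB Require Import structures.
From mathcomp Require Import all_boot all_order all_algebra.
From mathcomp Require Import reals exp.

Set Implicit Arguments.
Unset Strict Implicit.
Unset Printing Implicit Defensive.

Import Order.TTheory GRing.Theory Num.Theory VectorInternalTheory.
Local Open Scope ring_scope.

(* MathComp does not provide these for subspaces over a finite field. *)
Section VspaceFinite.
Variables (F : finFieldType) (vT : vectType F).
HB.instance Definition _ : isCountable {vspace vT} :=
  CanIsCountable (@vs2mxK F vT).
HB.instance Definition _ : isFinite {vspace vT} := CanIsFinite (@vs2mxK F vT).
End VspaceFinite.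

(* The index is an integer, not a natural number, since [qint q (-1)] occurs
   in [[l - 1] < s <= [l]] when s = 0 (and then l = 0). *)
Definition qint (R : realFieldType) (q : nat) (a : int) : R :=
  (q%:R ^ a - 1) / (q%:R - 1).

Definition qbinom (R : realFieldType) (q : nat) (a b : int) : R :=
  match b with
  | Posz m => \prod_(i < m) (qint R q (a - i%:Z) / qint R q (m%:Z - i%:Z))
  | Negz _ => 0
  end.

Section CameronLiebler.
Variables (F : finFieldType) (n : nat).
Local Notation subspace := {vspace 'rV[F]_n}.

(* Dimensions are vector space dimensions: points are 1-spaces. *)
Definition kspaces (k : nat) : {set subspace} := [set S | \dim S == k].
Definition points : {set subspace} := kspaces 1.
Definition hyperplanes : {set subspace} := [set H | (\dim H).+1 == n].

Definition kspaces_through (k : nat) (P : subspace) : {set subspace} :=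
  [set S in kspaces k | (P <= S)%VS].
Definition kspaces_in (k : nat) (H : subspace) : {set subspace} :=
  [set S in kspaces k | (S <= H)%VS].

(* Only the values of f on k-spaces matter; "degree 1" means "degree at most 1"
   in the indicator functions x_P of the relation P <= S, for P a point. *)
Definition degree1 (R : realFieldType) (k : nat) (f : subspace -> R) : Prop :=
  exists (c0 : R) (c : subspace -> R), forall S, S \in kspaces k ->
    f S = c0 + \sum_(P in points) c P * (P <= S)%VS%:R.

(* A Boolean function on k-spaces is given as the set where it takes value 1. *)
Definition Cameron_Liebler (R : realFieldType) (k : nat) (Y : {set subspace}) :
    Prop :=
  Y \subset kspaces k /\ degree1 k (fun S => (S \in Y)%:R : R).

Definition basic_trivial (k : nat) (Y : {set subspace}) : Prop :=
  [\/ Y = set0,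
      exists2 P, P \in points & Y = kspaces_through k P,
      exists2 H, H \in hyperplanes & Y = kspaces_in k H
    | exists P H, [/\ P \in points, H \in hyperplanes, ~~ (P <= H)%VS
                    & Y = kspaces_through k P :|: kspaces_in k H]].

Definition trivial_class (k : nat) (Y : {set subspace}) : Prop :=
  basic_trivial k Y \/ basic_trivial k (kspaces k :\: Y).

End CameronLiebler.

(* Main.v *)
(* Write f(S) for the indicator of Y. The constant can be absorbed, so that f(S)
   is the sum of weights x_P over the points P of S, and s is the sum of all x_P.
   Extend this by letting wt W be the sum of the x_P over the points P of a
   subspace W of any dimension. Call W full if every k-space through W is in Y.
   Averaging over the k-spaces through W shows that wt W is close to 1 if W is
   full; otherwise some S through W has wt S = 0, and as the x_P are bounded
   below by a tiny negative number -mu, wt W is close to 0.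

   If n > 2k and Y is nonempty, a minimal full subspace W must be a point, since
   otherwise the small weights of its hyperplanes could not add up to that of W.
   Remove from Y the k-spaces through this point; there is no second full point,
   so nothing is left.

   If n = 2k, consider S in Y and W < S < Z with dim W = k - 2, dim Z = k + 2.
   The k-spaces of Y between W and Z form a class of lines in a projective
   3-space, with parameter wt Z + q^2 wt W. If this parameter is small, then S
   contains a full point or lies in a full plane of this 3-space, since otherwise
   there would be too many pairwise skew lines meeting S. Comparing the members
   of Y through T with those below U, where T < S < U have dimensions k - 1 and
   k + 1, one of these T or U is then full in the whole space. The parameter is
   about 2 on average, so if no U above S is full, then many T below S are; their
   weights concentrate on a single point, which is therefore full. By duality,
   every nonempty class has a full point or a full hyperplane. At most one of
   each can be removed before the class becomes empty. *)

Require Import Defs.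
From mathcomp Require Import all_boot all_order all_algebra.
From mathcomp Require Import reals exp.
From mathcomp Require Import finfield ring lra zify.

Set Implicit Arguments.
Unset Strict Implicit.
Unset Printing Implicit Defensive.

Import Order.TTheory GRing.Theory Num.Theory VectorInternalTheory.
Local Open Scope ring_scope.

(** * Counting subspaces in an interval *)

Section GaussianNumbers.
Variables (R : realFieldType) (Q : R).
Hypothesis Q_ge2 : 2 <= Q.

Definition gnum (a : nat) : R := (Q ^+ a - 1) / (Q - 1).

(* The number of k-spaces between a w-space and a z-space. *)
Definition gcount (w k z : nat) : R :=
  \prod_(w <= i < k) (gnum (z - i) / gnum (k - i)).

Lemma base_subr1_neq0 : Q - 1 != 0.
Proof. by rewrite gt_eqF // subr_gt0; have h := Q_ge2; lra. Qed.

Lemma gnum0 : gnum 0 = 0.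
Proof. by rewrite /gnum expr0 subrr mul0r. Qed.

Lemma gnum1 : gnum 1 = 1.
Proof. by rewrite /gnum expr1 divff ?base_subr1_neq0. Qed.

Lemma gnum2 : gnum 2 = Q + 1.
Proof. by rewrite /gnum; field; exact: base_subr1_neq0. Qed.

Lemma gnumD a b : gnum (a + b) = gnum a + Q ^+ a * gnum b.
Proof. by rewrite /gnum exprD; field; exact: base_subr1_neq0. Qed.

Lemma gnumS a : gnum a.+1 = Q * gnum a + 1.
Proof. by rewrite -add1n gnumD gnum1 expr1 addrC. Qed.

Lemma gnum_ge0 a : 0 <= gnum a.
Proof.
elim: a => [|a IH]; first by rewrite gnum0.
by rewrite gnumS addr_ge0 // mulr_ge0 //; have h := Q_ge2; lra.
Qed.

Lemma gnumS_gt0 a : 0 < gnum a.+1.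
Proof.
rewrite gnumS ltr_wpDl // mulr_ge0 ?gnum_ge0 //; have h := Q_ge2; lra.
Qed.

Lemma gnum_gt0 a : (0 < a)%N -> 0 < gnum a.
Proof. by case: a => // a _; exact: gnumS_gt0. Qed.

Lemma gnum_neq0 a : (0 < a)%N -> gnum a != 0.
Proof. by move=> /gnum_gt0/lt0r_neq0. Qed.

Lemma expQ_ge1 a : 1 <= Q ^+ a.
Proof. by apply: exprn_ege1; have h := Q_ge2; lra. Qed.

Lemma expQ_gt0 a : 0 < Q ^+ a.
Proof. by apply: lt_le_trans (expQ_ge1 a). Qed.

Lemma le_gnum a b : (a <= b)%N -> gnum a <= gnum b.
Proof.
move=> /subnKC <-; rewrite gnumD lerDl mulr_ge0 ?gnum_ge0 // ltW //.
exact: expQ_gt0.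
Qed.

Lemma gcount_nil k z : gcount k k z = 1.
Proof. by rewrite /gcount big_geq. Qed.

Lemma gcount_rec w k z : (w < k)%N ->
  gcount w k z = gnum (z - w) / gnum (k - w) * gcount w.+1 k z.
Proof. by move=> wk; rewrite /gcount big_ltn. Qed.

Lemma gcountS w z : gcount w w.+1 z = gnum (z - w).
Proof. by rewrite gcount_rec // gcount_nil subSnn gnum1 divr1 mulr1. Qed.

Lemma gcountSS w z :
  gcount w w.+2 z = gnum (z - w) * gnum (z - w.+1) / (Q + 1).
Proof.
rewrite gcount_rec // gcountS.
have -> : (w.+2 - w = 2)%N by lia.
by rewrite gnum2 mulrAC.
Qed.

Lemma gcount_hyper w k : (w <= k)%N -> gcount w k k.+1 = gnum (k.+1 - w).
Proof.
move=> /subnKC <-; move: (k - w)%N => d; elim: d w => [|d IH] w.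
  by rewrite addn0 gcount_nil subSnn gnum1.
rewrite gcount_rec; last by rewrite addnS ltnS leq_addr.
have -> : (w + d.+1 = w.+1 + d)%N by rewrite addnS addSn.
rewrite IH.
have -> : (w.+1 + d - w = d.+1)%N by lia.
have -> : ((w.+1 + d).+1 - w.+1 = d.+1)%N by lia.
by rewrite divfK // gnum_neq0.
Qed.

Lemma gcount_codim2 w k : (w <= k)%N ->
  gcount w k k.+2 = gnum (k.+2 - w) * gnum (k.+1 - w) / (Q + 1).
Proof.
have Q1 : Q + 1 != 0 by rewrite gt_eqF //; have h := Q_ge2; lra.
move=> /subnKC <-; move: (k - w)%N => d; elim: d w => [|d IH] w.
  rewrite addn0 gcount_nil subSnn gnum1.
  have -> : (w.+2 - w = 2)%N by lia.
  by rewrite gnum2 mulr1 divff.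
rewrite gcount_rec; last by rewrite addnS ltnS leq_addr.
have -> : (w + d.+1 = w.+1 + d)%N by rewrite addnS addSn.
rewrite IH.
have -> : (w.+1 + d - w = d.+1)%N by lia.
have -> : ((w.+1 + d).+1 - w.+1 = d.+1)%N by lia.
have -> : ((w.+1 + d).+2 - w.+1 = d.+2)%N by lia.
have -> : ((w.+1 + d).+1 - w = d.+2)%N by lia.
have G := gnum_neq0 (ltn0Sn d).
by field; rewrite G Q1.
Qed.

Lemma gcount_gt0 w k z : (k <= z)%N -> 0 < gcount w k z.
Proof.
move=> kz; rewrite /gcount big_nat; apply: prodr_gt0 => i /andP[_ ik].
by rewrite divr_gt0 // gnum_gt0 // subn_gt0 // (leq_trans ik).
Qed.

End GaussianNumbers.

(** * Points, intervals and weights of subspaces *)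

Section Subspaces.
Variables (F : finFieldType) (n : nat).
Local Notation subspace := {vspace 'rV[F]_n}.
Implicit Types (P S T U W Z : subspace) (k w z : nat).

Definition interval k W Z : {set subspace} :=
  [set S in kspaces F n k | (W <= S)%VS && (S <= Z)%VS].

Lemma in_kspaces k S : (S \in kspaces F n k) = (\dim S == k).
Proof. by rewrite inE. Qed.

Lemma in_points P : (P \in points F n) = (\dim P == 1%N).
Proof. by rewrite inE. Qed.

Lemma in_interval k W Z S :
  (S \in interval k W Z) = [&& \dim S == k, (W <= S)%VS & (S <= Z)%VS].
Proof. by rewrite !inE. Qed.

Lemma eq_dim_subv U V : (U <= V)%VS -> (\dim V <= \dim U)%N -> U = V.
Proof. by move=> UV VU; apply/eqP; rewrite eqEdim UV. Qed.

Lemma interval_nil W Z : (W <= Z)%VS -> interval (\dim W) W Z = [set W].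
Proof.
move=> WZ; apply/setP => S; rewrite in_interval inE.
apply/idP/eqP => [/and3P[/eqP dS WS _]|->]; last by rewrite eqxx subvv.
by rewrite (eq_dim_subv WS) // dS.
Qed.

Lemma vline_point (v : 'rV[F]_n) : v != 0 -> <[v]>%VS \in points F n.
Proof. by move=> v0; rewrite in_points dim_vline v0. Qed.

Lemma point_vline P (v : 'rV[F]_n) :
  P \in points F n -> v \in P -> v != 0 -> P = <[v]>%VS.
Proof.
rewrite in_points => /eqP dP vP v0; apply/esym/eq_dim_subv.
  by rewrite -memvE.
by rewrite dP dim_vline v0.
Qed.

Lemma dim_add_point W P : P \in points F n -> ~~ (P <= W)%VS ->
  \dim (W + P) = (\dim W).+1.
Proof.
rewrite in_points => /eqP dP PW.
have := dimv_sum_cap W P; rewrite dP addn1.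
suff -> : \dim (W :&: P) = 0%N by rewrite addn0.
apply/eqP; rewrite -leqn0 -ltnS ltnNge; apply: contra PW => le.
by rewrite -(eq_dim_subv (capvSr W P)) ?capvSl // dP.
Qed.

Variable R : realFieldType.
Local Notation Q := (#|F|%:R : R).
Local Notation gn := (gnum Q).
Local Notation gc := (gcount Q).

Lemma card_field_ge2 : 2 <= Q.
Proof. by rewrite ler_nat; exact: finNzRing_gt1. Qed.
Local Notation Q2 := card_field_ge2.

(** A nonzero vector of [U] lies in exactly one point, namely its span, so the points partition the
    nonzero vectors. *)
Lemma sum_points_in (U : subspace) (g : 'rV[F]_n -> R) :
  \sum_(v in U | v != 0) g v =
  \sum_(P in points F n | (P <= U)%VS) \sum_(v in P | v != 0) g v.
Proof.
rewrite (exchange_big_dep [pred v | (v \in U) && (v != 0)]) /=; last first.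
  move=> P v /andP[_ PU] /andP[vP v0]; rewrite v0 andbT.
  exact: (subvP PU).
apply: eq_bigr => v /andP[vU v0].
rewrite (big_pred1 <[v]>%VS) // => P /=.
apply/idP/eqP => [/and3P[/andP[Pp _] vP _]|->].
  exact: point_vline.
by rewrite vline_point // -memvE vU memv_line v0.
Qed.

Lemma card_nonzero (U : subspace) :
  \sum_(v in U | v != 0) (1 : R) = Q ^+ \dim U - 1.
Proof.
rewrite -natrX -(@card_vspace F 'rV[F]_n) -sumr_const [in RHS](bigD1 0) ?mem0v //=.
by rewrite [RHS]addrAC subrr add0r.
Qed.

Lemma card_points_in (U : subspace) :
  \sum_(P in points F n | (P <= U)%VS) (1 : R) = gn (\dim U).
Proof.
rewrite /gnum -card_nonzero sum_points_in.
under [in RHS]eq_bigr => P /andP[Pp _].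
  rewrite card_nonzero; move: Pp; rewrite in_points => /eqP ->.
  rewrite expr1 -[Q - 1]mul1r; over.
by rewrite -mulr_suml mulfK // base_subr1_neq0 // Q2.
Qed.

Lemma sum_split_points W Z (g : subspace -> R) : (W <= Z)%VS ->
  \sum_(P in points F n | (P <= Z)%VS) g P =
  \sum_(P in points F n | (P <= W)%VS) g P +
  \sum_(P in points F n | (P <= Z)%VS && ~~ (P <= W)%VS) g P.
Proof.
move=> WZ; rewrite (bigID (fun P => P <= W)%VS) /=; congr (_ + _).
  apply: eq_bigl => P; rewrite -andbA; congr andb; apply/andP/idP => [[]//|PW].
  by split => //; exact: subv_trans WZ.
by apply: eq_bigl => P; rewrite andbA.
Qed.

Lemma card_points_diff W Z : (W <= Z)%VS ->
  \sum_(P in points F n | (P <= Z)%VS && ~~ (P <= W)%VS) (1 : R) =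
  gn (\dim Z) - gn (\dim W).
Proof.
by move=> WZ; rewrite -!card_points_in (sum_split_points _ WZ) addrAC subrr add0r.
Qed.

Lemma interval_addP k W Z P :
  [set S in interval k W Z | (P <= S)%VS] = interval k (W + P) Z.
Proof. by apply/setP => S; rewrite !inE subv_add -!andbA; do !bool_congr. Qed.

Lemma card_interval k W Z : (W <= Z)%VS -> (\dim W <= k)%N ->
  #|interval k W Z|%:R = gc (\dim W) k (\dim Z).
Proof.
move=> WZ /subnKC; move: (k - _)%N => d; elim: d W WZ => [|d IH] W WZ.
  by rewrite addn0 => <-; rewrite interval_nil // cards1 gcount_nil.
move=> dk.
have wk : (\dim W < k)%N by rewrite -dk -addSnnS leq_addr.
have kw0 : gn (k - \dim W) != 0 by rewrite gnum_neq0 ?Q2 // subn_gt0.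
have kE : gn k - gn (\dim W) = Q ^+ \dim W * gn (k - \dim W).
  by rewrite -{1}(subnKC (ltnW wk)) gnumD ?Q2 // addrAC subrr add0r.
have zE : gn (\dim Z) - gn (\dim W) = Q ^+ \dim W * gn (\dim Z - \dim W).
  by rewrite -{1}(subnKC (dimvS WZ)) gnumD ?Q2 // addrAC subrr add0r.
have W0 : Q ^+ \dim W != 0 by rewrite lt0r_neq0 // expQ_gt0 // Q2.
(* Double count the pairs of an [S] in the interval and a point [P] of [S] outside [W]. For fixed
   [P] these [S] form the interval above [W + P], to which the induction hypothesis applies. *)
have E : #|interval k W Z|%:R * (gn k - gn (\dim W)) =
         (gn (\dim Z) - gn (\dim W)) * gc (\dim W).+1 k (\dim Z).
  rewrite -card_points_diff // mulr_suml -sum1_card natr_sum mulr_suml.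
  transitivity (\sum_(S in interval k W Z)
    \sum_(P in points F n | (P <= S)%VS && ~~ (P <= W)%VS) (1 : R)).
    apply: eq_bigr => S; rewrite in_interval => /and3P[/eqP dS WS _].
    by rewrite mul1r (card_points_diff WS) dS.
  rewrite (exchange_big_dep
    [pred P | (P \in points F n) && ((P <= Z)%VS && ~~ (P <= W)%VS)]) /=.
    apply: eq_bigr => P /and3P[Pp PZ PW]; rewrite mul1r.
    rewrite -(dim_add_point Pp PW) -IH; last 2 first.
    - by rewrite subv_add WZ.
    - by rewrite (dim_add_point Pp PW) addSnnS.
    rewrite -interval_addP -sum1_card natr_sum; apply: eq_bigl => S.
    by rewrite [in RHS]inE Pp PW andbT.
  move=> S P; rewrite in_interval => /and3P[_ _ SZ] /and3P[-> PS ->].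
  by rewrite (subv_trans PS SZ).
rewrite gcount_rec //.
apply: (mulIf (mulf_neq0 W0 kw0)); rewrite -[in LHS]kE E zE.
by field; exact: kw0.
Qed.

Definition wt (x : subspace -> R) S : R :=
  \sum_(P in points F n | (P <= S)%VS) x P.

(** A point of [W] lies in every [S] of the interval, and a point of [Z] outside [W] only in those
    above [W + P]. Exchanging the sums gives the two terms. *)
Lemma sum_wt_interval x k W Z : (W <= Z)%VS -> (\dim W < k)%N ->
  \sum_(S in interval k W Z) wt x S =
  gc (\dim W) k (\dim Z) * wt x W +
  gc (\dim W).+1 k (\dim Z) * (wt x Z - wt x W).
Proof.
move=> WZ wk; rewrite {1}/wt (exchange_big_dep
  [pred P | (P \in points F n) && (P <= Z)%VS]) /=; last first.
  move=> S P; rewrite in_interval => /and3P[_ _ SZ] /andP[-> PS] /=.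
  exact: subv_trans SZ.
have sE P : P \in points F n -> (P <= Z)%VS ->
    \sum_(S in interval k W Z | (P \in points F n) && (P <= S)%VS) x P =
    gc (\dim (W + P)) k (\dim Z) * x P.
  move=> Pp PZ; rewrite -card_interval; last 2 first.
  - by rewrite subv_add WZ.
  - have [PW|PW] := boolP (P <= W)%VS; last by rewrite dim_add_point.
    by rewrite (addv_idPl PW) ltnW.
  rewrite -interval_addP -sum1_card natr_sum mulr_suml; apply: eq_big => [S|S _].
    by rewrite [in RHS]inE Pp.
  by rewrite mul1r.
rewrite (sum_split_points _ WZ); congr (_ + _).
  rewrite /wt mulr_sumr; apply: eq_bigr => P /andP[Pp PW].
  by rewrite sE ?(subv_trans PW WZ) // (addv_idPl PW).
rewrite {1}/wt (sum_split_points x WZ) /wt addrAC subrr add0r mulr_sumr.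
by apply: eq_bigr => P /and3P[Pp PZ PW]; rewrite sE // dim_add_point.
Qed.

End Subspaces.

(** * The middle layer of an interval *)

(* The identities in this section generalise those of line classes in a
   3-dimensional projective space: S plays the role of a line, T of a point
   on S, and U of a plane through S. *)
Section MiddleLayer.
Variables (R : realFieldType) (F : finFieldType) (n : nat).
Local Notation subspace := {vspace 'rV[F]_n}.
Local Notation Q := (#|F|%:R : R).
Local Notation gn := (gnum Q).
Local Notation Q2 := (card_field_ge2 F R).
Lemma sum_wt_pencil (x : subspace -> R) k (T U : subspace) : (T <= U)%VS -> (\dim T).+1 = k ->
  \dim U = k.+1 -> \sum_(S in interval k T U) wt x S = Q * wt x T + wt x U.
Proof.
move=> TU Tk Uk; rewrite sum_wt_interval // -?Tk //.
rewrite gcountS ?Q2 // gcount_nil Uk -Tk.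
have -> : ((\dim T).+2 - \dim T = 2)%N by lia.
by rewrite gnum2 ?Q2 //; ring.
Qed.

Variables (x : subspace -> R) (W Z : subspace) (d k : nat).
Hypotheses (WZ : (W <= Z)%VS) (kE : k = (\dim W + d.+1)%N).
Hypothesis ZE : \dim Z = (k + d.+1)%N.

(** The parameter of the class that [Y] induces on the quotient of [Z] by [W]: multiplied by the
    number of k-spaces of the interval through a fixed space one dimension above [W], it gives the
    number of members of [Y] in the interval. *)
Definition weight_param : R := wt x Z + Q ^+ d.+1 * wt x W.

Lemma sum_wt_up (T : subspace) : (T <= Z)%VS -> (\dim T).+1 = k ->
  \sum_(S in interval k T Z) wt x S = Q * gn d.+1 * wt x T + wt x Z.
Proof.
move=> TZ Tk; rewrite sum_wt_interval // -?Tk //.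
rewrite gcountS ?Q2 // gcount_nil ZE.
have -> : (k + d.+1 - \dim T = d.+2)%N by lia.
by rewrite gnumS ?Q2 //; ring.
Qed.

Lemma sum_wt_down (U : subspace) : (W <= U)%VS -> \dim U = k.+1 ->
  \sum_(S in interval k W U) wt x S = Q ^+ d.+1 * wt x W + gn d.+1 * wt x U.
Proof.
move=> WU Uk; rewrite sum_wt_interval //; last by rewrite kE addnS ltnS leq_addr.
rewrite Uk !gcount_hyper ?Q2 //; try lia.
have -> : (k.+1 - \dim W = d.+1 + 1)%N by lia.
have -> : (k.+1 - (\dim W).+1 = d.+1)%N by lia.
by rewrite gnumD ?Q2 // gnum1 ?Q2 //; ring.
Qed.

(** All three sums are linear in the weights of [W], [T], [U] and [Z]. This is the classical
    relation between the lines of a class through a point, those in a plane, and those in the pencil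
    of both. *)
Lemma sum_up_down (T U : subspace) : (W <= T)%VS -> (T <= U)%VS ->
  (U <= Z)%VS -> (\dim T).+1 = k -> \dim U = k.+1 ->
  \sum_(S in interval k T Z) wt x S + \sum_(S in interval k W U) wt x S =
  gn d.+1 * (\sum_(S in interval k T U) wt x S) + weight_param.
Proof.
move=> WT TU UZ Tk Uk; rewrite sum_wt_up ?(subv_trans TU) //.
rewrite sum_wt_down ?(subv_trans WT) // sum_wt_pencil // /weight_param.
by ring.
Qed.

Hypothesis d_gt0 : (0 < d)%N.

(** For an [S] outside [Y] the right side is just [gn d.+1 * weight_param], which is how it bounds
    the members through a single [T]. *)
Lemma sum_sum_wt_up (S : subspace) : S \in interval k W Z ->
  \sum_(T in interval k.-1 W S) \sum_(S' in interval k T Z) wt x S' =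
  gn d.+1 * (weight_param + Q * gn d * wt x S).
Proof.
rewrite in_interval => /and3P[/eqP dS WS SZ].
transitivity (\sum_(T in interval k.-1 W S) (Q * gn d.+1 * wt x T + wt x Z)).
  apply: eq_bigr => T; rewrite in_interval => /and3P[/eqP dT WT TS].
  rewrite sum_wt_up ?(subv_trans TS) //; lia.
have k1 : k = k.-1.+1 by lia.
have wk1 : (\dim W < k.-1)%N by lia.
rewrite big_split /= -mulr_sumr sum_wt_interval // sumr_const.
rewrite -[_ *+ #|interval _ _ _|]mulr_natr.
rewrite card_interval ?(ltnW wk1) // dS.
rewrite (_ : gcount Q _ _ _ = gn d.+1); last first.
  by rewrite [X in gcount _ _ _ X]k1 gcount_hyper ?Q2 ?(ltnW wk1) //; congr gn; lia.
rewrite (_ : gcount Q _.+1 _ _ = gn d); last first.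
  by rewrite [X in gcount _ _ _ X]k1 gcount_hyper ?Q2 //; congr gn; lia.
have -> : gn d.+1 = gn d + Q ^+ d by rewrite -addn1 gnumD ?Q2 // gnum1 ?Q2 // mulr1.
by rewrite /weight_param exprS; ring.
Qed.

Lemma sum_sum_wt_down (S : subspace) : S \in interval k W Z ->
  \sum_(U in interval k.+1 S Z) \sum_(S' in interval k W U) wt x S' =
  gn d.+1 * (weight_param + Q * gn d * wt x S).
Proof.
rewrite in_interval => /and3P[/eqP dS WS SZ].
transitivity (\sum_(U in interval k.+1 S Z)
    (Q ^+ d.+1 * wt x W + gn d.+1 * wt x U)).
  apply: eq_bigr => U; rewrite in_interval => /and3P[/eqP dU SU UZ].
  by rewrite sum_wt_down ?(subv_trans WS) //.
rewrite big_split /= sumr_const -mulr_sumr sum_wt_interval ?dS //.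
rewrite -[_ *+ #|interval _ _ _|]mulr_natr.
rewrite card_interval ?dS // gcountS ?Q2 // gcount_nil ZE addKn.
have -> : gn d.+1 = Q * gn d + 1 by rewrite gnumS ?Q2.
by rewrite /weight_param; ring.
Qed.

Variable Y : {set subspace}.
Hypothesis xY : forall S, \dim S = k -> wt x S = (S \in Y)%:R.

Lemma sum_wt_ge0 (A B : subspace) : 0 <= \sum_(S in interval k A B) wt x S.
Proof.
apply: sumr_ge0 => S; rewrite in_interval => /and3P[/eqP dS _ _].
by rewrite xY.
Qed.

(** The sum over [T] is one of the nonnegative terms of the double sum in [sum_sum_wt_up], taken at
    an [S] of weight 0. *)
Lemma up_bound (T S : subspace) : (W <= T)%VS -> (\dim T).+1 = k ->
  S \in interval k T Z -> S \notin Y ->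
  \sum_(S' in interval k T Z) wt x S' <= gn d.+1 * weight_param.
Proof.
move=> WT dT; rewrite in_interval => /and3P[/eqP dS TS SZ] SY.
have SI : S \in interval k W Z by rewrite in_interval dS eqxx (subv_trans WT) ?SZ.
have := sum_sum_wt_up SI; rewrite xY // (negbTE SY) mulr0 addr0 => <-.
rewrite [leRHS](bigD1 T) /=; last by rewrite in_interval WT TS -dT eqxx.
by rewrite lerDl sumr_ge0 // => T' _; exact: sum_wt_ge0.
Qed.

Lemma down_bound (U S : subspace) : (U <= Z)%VS -> \dim U = k.+1 ->
  S \in interval k W U -> S \notin Y ->
  \sum_(S' in interval k W U) wt x S' <= gn d.+1 * weight_param.
Proof.
move=> UZ dU; rewrite in_interval => /and3P[/eqP dS WS SU] SY.
have SI : S \in interval k W Z by rewrite in_interval dS eqxx WS (subv_trans SU).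
have := sum_sum_wt_down SI; rewrite xY // (negbTE SY) mulr0 addr0 => <-.
rewrite [leRHS](bigD1 U) /=; last by rewrite in_interval dU SU UZ eqxx.
by rewrite lerDl sumr_ge0 // => T' _; exact: sum_wt_ge0.
Qed.

End MiddleLayer.

(** * Line classes in an interval of length four *)

Ltac dim_lia := clear;
  repeat match goal with |- context [@dimv ?K ?V ?U] =>
    move: (@dimv K V U) => ? end; lia.

Lemma gnum3 (R : realFieldType) (Q : R) : 2 <= Q -> gnum Q 3 = Q ^+ 2 + Q + 1.
Proof. by move=> Q2; rewrite gnumS // gnum2 //; ring. Qed.

Section LineClass.
Variables (R : realFieldType) (F : finFieldType) (n : nat).
Local Notation subspace := {vspace 'rV[F]_n}.
Local Notation Q := (#|F|%:R : R).
Local Notation gn := (gnum Q).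
Local Notation Q2 := (card_field_ge2 F R).
Variables (x : subspace -> R) (W Z : subspace) (k : nat) (Y : {set subspace}).
Hypotheses (WZ : (W <= Z)%VS) (kE : k = (\dim W + 2)%N).
Hypothesis ZE : \dim Z = (k + 2)%N.
Hypothesis xY : forall S, \dim S = k -> wt x S = (S \in Y)%:R.

Local Notation param := (weight_param x W Z 1).
Definition lines := [set S in interval k W Z | S \in Y].
(** A member [S] counts as meeting itself. *)
Definition meeting (S : subspace) := [set S' in lines | (S :&: S')%VS != W].

Lemma in_lines (S : subspace) :
  (S \in lines) = [&& \dim S == k, (W <= S)%VS, (S <= Z)%VS & S \in Y].
Proof. by rewrite !inE -!andbA. Qed.

Lemma in_meeting (S S' : subspace) :
  (S' \in meeting S) = (S' \in lines) && ((S :&: S')%VS != W).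
Proof. by rewrite inE. Qed.

Lemma sum_wt_card (A B : subspace) : (W <= A)%VS -> (B <= Z)%VS ->
  \sum_(S in interval k A B) wt x S =
  \sum_(S in lines) ((A <= S)%VS && (S <= B)%VS)%:R.
Proof.
move=> WA BZ; rewrite (bigID (fun S => S \in Y)) /= addrC big1 ?add0r; last first.
  move=> S /andP[]; rewrite in_interval => /and3P[/eqP dS _ _] SY.
  by rewrite xY // (negbTE SY).
rewrite [RHS](bigID (fun S => (A <= S)%VS && (S <= B)%VS)) /=.
rewrite [X in _ = _ + X]big1 ?addr0; last by move=> S /andP[_ /negbTE->].
apply: eq_big => [S|S].
  rewrite in_interval in_lines; apply/andP/andP => -[].
    move=> /and3P[-> AS SB] ->.
    by rewrite (subv_trans WA AS) (subv_trans SB BZ) AS SB.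
  by move=> /and4P[-> _ _ ->] ->.
by rewrite in_interval => /andP[/and3P[/eqP dS -> ->] SY]; rewrite xY // SY.
Qed.

Lemma card_lines : #|lines|%:R = gn 3 * param.
Proof.
transitivity (\sum_(S in interval k W Z) wt x S).
  rewrite sum_wt_card ?subvv // -sum1_card natr_sum; apply: eq_bigr => S.
  by rewrite in_lines => /and4P[_ -> ->].
rewrite sum_wt_interval // kE addn2 // gcountSS ?Q2 // gcountS ?Q2 // ZE kE.
have -> : (\dim W + 2 + 2 - \dim W = 4)%N by lia.
have -> : (\dim W + 2 + 2 - (\dim W).+1 = 3)%N by lia.
rewrite gnumS ?Q2 // gnum3 ?Q2 // /weight_param.
have Q2 := Q2; field; rewrite gt_eqF //; lra.
Qed.

Lemma dim_pairs (S S' : subspace) : \dim S = k -> \dim S' = k -> S != S' ->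
  (\dim (S :&: S') < k)%N.
Proof.
move=> dS dS' SS'; rewrite ltnNge; apply: contra SS' => le.
have E := eq_dim_subv (capvSl S S'); have E' := eq_dim_subv (capvSr S S').
by rewrite -{1}E ?dS // E' ?dS'.
Qed.

(** The double sum of [sum_sum_wt_up] counts each other line meeting [S] once, at its common point
    with [S], but counts [S] itself [Q + 1] times; hence the correction by [Q]. *)
Lemma meeting_ge (S : subspace) : S \in lines ->
  (Q + 1) * (param + Q) - Q <= #|meeting S|%:R.
Proof.
move=> SL; have := SL; rewrite in_lines => /and4P[/eqP dS WS SZ SY].
have SI : S \in interval k W Z by rewrite in_interval dS eqxx WS SZ.
have := sum_sum_wt_up x WZ kE ZE (ltn0Sn 0) SI.
rewrite gnum2 ?Q2 // xY // SY gnum1 ?Q2 // !mulr1 => <-.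
rewrite (eq_bigr (fun T => \sum_(S' in lines) ((T <= S')%VS)%:R)); last first.
  move=> T; rewrite in_interval => /and3P[_ WT TS].
  rewrite sum_wt_card ?subvv //; apply: eq_bigr => S'; rewrite in_lines.
  by move=> /and4P[_ _ ->]; rewrite andbT.
rewrite exchange_big /= lerBlDr.
have -> : #|meeting S|%:R + Q =
    \sum_(S' in lines) (((S :&: S')%VS != W)%:R + (S' == S)%:R * Q).
  rewrite big_split /=; congr (_ + _).
    rewrite -sum1_card natr_sum big_mkcond [RHS]big_mkcond; apply: eq_bigr => S' _.
    by rewrite [in LHS]inE; case: (S' \in lines); case: (_ != W).
  rewrite (bigD1 S) //= eqxx mul1r big1 ?addr0 // => S' /andP[_ /negbTE->].
  by rewrite mul0r.
apply: ler_sum => S'; rewrite in_lines => /and4P[/eqP dS' WS' _ _].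
have -> : \sum_(T in interval k.-1 W S) ((T <= S')%VS)%:R =
    #|[set T in interval k.-1 W S | (T <= S')%VS]|%:R :> R.
  rewrite -sum1_card natr_sum big_mkcond [RHS]big_mkcond; apply: eq_bigr => T _.
  by rewrite [in RHS]inE; case: (T \in interval _ _ _); case: (T <= S')%VS.
have [->|SS'] := eqVneq S' S.
  rewrite mul1r capvv.
  have WneS : S != W.
    by apply/eqP => E; have := dS; rewrite E kE addn2 => /eqP; rewrite ltn_eqF.
  rewrite WneS; apply: (@le_trans _ _ (#|interval k.-1 W S|%:R)).
    by rewrite ler_nat subset_leq_card //; apply/subsetP => T; rewrite inE => /andP[].
  rewrite card_interval //; last by rewrite kE addn2 leqnSn.
  rewrite kE addn2 /= gcountS ?Q2 // dS kE addKn gnum2 ?Q2 // addrC.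
  exact: lexx.
rewrite mul0r addr0 ler_nat.
have [SW|SW] := eqVneq (S :&: S')%VS W.
  rewrite leqn0 cards_eq0; apply/eqP/setP => T; rewrite in_set0.
  apply/negP; rewrite !inE => /andP[/andP[/eqP dT /andP[WT TS]] TS'].
  have : (T <= W)%VS by rewrite -SW subv_cap TS.
  by move=> /dimvS; rewrite dT kE addn2 ltnn.
apply: (@leq_trans #|[set (S :&: S')%VS]|); last by rewrite cards1.
apply: subset_leq_card; apply/subsetP => T; rewrite !inE.
move=> /andP[/andP[/eqP dT /andP[WT TS]] TS']; apply/eqP/eq_dim_subv.
  by rewrite subv_cap TS.
have := dim_pairs dS dS'; rewrite eq_sym SS' dT => /(_ isT).
by rewrite kE addn2 ltnS.
Qed.

Lemma dim_skew (S S' : subspace) : S \in lines -> S' \in lines ->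
  (S :&: S')%VS = W -> (S + S')%VS = Z.
Proof.
rewrite !in_lines => /and4P[/eqP dS _ SZ _] /and4P[/eqP dS' _ SZ' _] SS'.
apply: eq_dim_subv; first by rewrite subv_add SZ.
have := dimv_sum_cap S S'; rewrite SS' dS dS' ZE kE. dim_lia.
Qed.

(** A line meeting both skew lines lies in the pencil of [T] and [T + S2], where [T] is its point on
    [S1]. Summed over all [T] on [S1], these pencils have total weight [Q *+ 2 + param]. *)
Lemma common_meeting_le (S1 S2 : subspace) : S1 \in lines -> S2 \in lines ->
  (S1 :&: S2)%VS = W -> #|meeting S1 :&: meeting S2|%:R <= Q *+ 2 + param.
Proof.
move=> L1 L2 S12; have SZ := dim_skew L1 L2 S12.
have := L1; have := L2; rewrite !in_lines.
move=> /and4P[/eqP d2 W2 S2Z Y2] /and4P[/eqP d1 W1 S1Z Y1].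
have capT T : (W <= T)%VS -> (T <= S1)%VS -> (T :&: S2)%VS = W.
  move=> WT TS; apply/eqP; rewrite eqEsubv subv_cap WT W2 !andbT.
  by rewrite -S12 capvS ?subvv.
have dTU T : T \in interval k.-1 W S1 -> \dim (T + S2) = k.+1.
  rewrite in_interval => /and3P[/eqP dT WT TS].
  by have := dimv_sum_cap T S2; rewrite capT // dT d2 kE; dim_lia.
have -> : Q *+ 2 + param = \sum_(T in interval k.-1 W S1)
    \sum_(S in interval k T (T + S2)) wt x S.
  rewrite (eq_bigr (fun T => Q * wt x T + wt x (T + S2))); last first.
    move=> T TI; rewrite sum_wt_pencil ?addvSl ?dTU //.
    by move: TI; rewrite in_interval => /and3P[/eqP->]; rewrite kE addn2.
  rewrite big_split /= -mulr_sumr.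
  have -> : \sum_(T in interval k.-1 W S1) wt x (T + S2) =
            \sum_(U in interval k.+1 S2 Z) wt x U.
    (* As [S1] and [S2] are skew, [T + S2] runs once through the planes on [S2], with inverse
       [U :&: S1]. *)
    rewrite [RHS](reindex_onto (fun T => T + S2)%VS (fun U => U :&: S1)%VS) /=.
      apply: eq_bigl => T; rewrite !in_interval.
      apply/idP/andP => [TI|[/and3P[/eqP dU _ UZ] /eqP <-]].
        have TI' : T \in interval k.-1 W S1 by rewrite in_interval.
        have dU := dTU _ TI'; have /and3P[/eqP dT WT TS] := TI.
        rewrite dU eqxx addvSr subv_add (subv_trans TS S1Z) S2Z; split => //.
        apply/eqP/esym/eq_dim_subv; first by rewrite subv_cap addvSl.
        have := dimv_sum_cap (T + S2) S1; rewrite dU d1 dT.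
        suff -> : (T + S2 + S1)%VS = Z by rewrite ZE kE; dim_lia.
        apply/eq_dim_subv; last first.
          by rewrite -SZ dimvS // subv_add addvSr (subv_trans (addvSr T S2)) ?addvSl.
        by rewrite !subv_add (subv_trans TS S1Z) S2Z.
      rewrite subv_cap W1 (subv_trans W2 (addvSr _ _)) capvSr !andbT.
      have := dimv_sum_cap (T + S2) S1; rewrite dU d1.
      suff -> : (T + S2 + S1)%VS = Z by rewrite ZE kE; dim_lia.
      apply/eq_dim_subv; first by rewrite subv_add UZ.
      by rewrite -SZ dimvS // subv_add addvSr (subv_trans (addvSr T S2)) ?addvSl.
    move=> U; rewrite in_interval => /and3P[/eqP dU SU UZ].
    apply: eq_dim_subv; first by rewrite subv_add capvSl.
    have := dimv_sum_cap (U :&: S1) S2; have := dimv_sum_cap U S1.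
    have -> : (U :&: S1 :&: S2)%VS = W by rewrite -capvA S12; apply/capv_idPr/(subv_trans W2).
    have -> : (U + S1)%VS = Z.
      apply/eq_dim_subv; first by rewrite subv_add UZ.
      by rewrite -SZ dimvS // subv_add addvSr (subv_trans SU) ?addvSl.
    by rewrite dU d1 d2 ZE kE; dim_lia.
  have I1 : S1 \in interval k W Z by rewrite in_interval d1 eqxx W1.
  rewrite !sum_wt_interval ?d2 //; last by rewrite kE addn2.
  have -> : k.-1 = (\dim W).+1 by rewrite kE addn2.
  rewrite !gcountS ?Q2 // !gcount_nil ZE d1 addKn (xY d1) (xY d2) Y1 Y2.
  have -> : (k - \dim W = 2)%N by rewrite kE addKn.
  by rewrite gnum2 ?Q2 // /weight_param mulr1n; ring.
rewrite (eq_bigr (fun T =>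
    \sum_(S in lines) ((T <= S)%VS && (S <= T + S2)%VS)%:R)); last first.
  move=> T; rewrite in_interval => /and3P[_ WT TS].
  by rewrite sum_wt_card // subv_add (subv_trans TS).
rewrite exchange_big /= -sum1_card natr_sum.
rewrite [leLHS]big_mkcond [leRHS]big_mkcond /=; apply: ler_sum => S _.
rewrite in_setI ![S \in meeting _]in_meeting; have [SL|//] := boolP (S \in lines).
have := SL; rewrite in_lines => /and4P[/eqP dS WS SZ' YS].
case: ifP => [/andP[/= m1 m2]|_]; last by apply: sumr_ge0.
have cap_dim S' : \dim S' = k -> (W <= S')%VS -> (S' :&: S)%VS != W ->
    (k.-1 <= \dim (S' :&: S))%N.
  move=> dS' WS' h; rewrite leqNgt; apply: contra h => lt.
  by apply/eqP/esym/eq_dim_subv; [rewrite subv_cap WS'|move: lt; rewrite kE; dim_lia].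
have SS1 : S1 != S.
  by apply: contraNneq m2 => <-; rewrite capvC S12.
have SS2 : S2 != S.
  by apply: contraNneq m1 => <-; rewrite S12.
have e1 := cap_dim _ d1 W1 m1; have e1' := dim_pairs d1 dS SS1.
have e2 := cap_dim _ d2 W2 m2; have e2' := dim_pairs d2 dS SS2.
(* The points of [S] on [S1] and on [S2] span [S], so [S] is counted at [T = S1 :&: S]. *)
have TI : (S1 :&: S)%VS \in interval k.-1 W S1.
  rewrite in_interval subv_cap W1 WS capvSl !andbT; move: e1 e1'; dim_lia.
rewrite (bigD1 (S1 :&: S)%VS) //= capvSr.
suff -> : (S <= S1 :&: S + S2)%VS by rewrite lerDl sumr_ge0.
suff E : (S1 :&: S + S2 :&: S)%VS = S by rewrite -[X in (X <= _)%VS]E addvS ?subvv ?capvSl.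
apply: eq_dim_subv; first by rewrite subv_add !capvSr.
have := dimv_sum_cap (S1 :&: S) (S2 :&: S).
have -> : (S1 :&: S :&: (S2 :&: S))%VS = W.
  apply/eqP; rewrite eqEsubv !subv_cap W1 W2 WS !andbT.
  by rewrite -[X in (_ <= X)%VS]S12 capvS ?capvSl.
by move: e1 e1' e2 e2'; rewrite dS kE; dim_lia.
Qed.

End LineClass.

(** The final estimate of [card_skew_family]: the left side is twice the number of all lines for
    parameter [a], the right side a lower bound for the sum of [d (3 - d)] over a skew family of
    size [a + 1]. *)
Lemma skew_count_contra (R : realFieldType) (a q : R) : 0 <= a -> 2 <= q ->
  4 * (a * a) <= q ->
  2 * ((q ^+ 2 + q + 1) * a) <
  (2 * ((q + 1) * (a + q) - q) - a * (q *+ 2 + a)) * (a + 1).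
Proof.
move=> a0 q2 aq.
have aaa : a * (a * a) <= a * (q / 4) by apply: ler_wpM2l => //; lra.
have a2 : 2 * a <= q.
  by rewrite -(@ler_pXn2r _ 2) ?nnegrE //; [nra|lra|lra].
have aq2 : a * q <= q / 2 * q by apply: ler_wpM2r; lra.
have qq : 0 < q * q by apply: mulr_gt0; lra.
have a_sq : 0 <= a * a by apply: mulr_ge0.
rewrite -subr_gt0.
have -> : (2 * ((q + 1) * (a + q) - q) - a * (q *+ 2 + a)) * (a + 1) -
   2 * ((q ^+ 2 + q + 1) * a) =
   2 * (q * q) + a * a - a * (a * a) - 2 * (a * q) by ring.
lra.
Qed.

(** The final estimate of [skew_extend]: the left side bounds the forbidden lines, with [c] the size
    of the family, 1 for the base line, and [m] the number of lines meeting the base line. *)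
Lemma skew_extend_contra (R : realFieldType) (a q c m : R) :
  a = 0 \/ 1 <= a -> 2 <= q -> 4 * (a * a) <= q -> c <= a ->
  (q + 1) * (a + q) - q <= m -> 1 + 2 * ((q + 1) * a) * c < m.
Proof.
move=> a01 q2 aq ca m1; apply: lt_le_trans m1.
have a0 : 0 <= a by case: a01 => [->//|]; lra.
have h1 : 2 * ((q + 1) * a) * c <= 2 * ((q + 1) * a) * a.
  by rewrite ler_wpM2l // mulr_ge0 // mulr_ge0 //; lra.
have h2 : 2 * ((q + 1) * a) * a <= (q + 1) * (q / 2).
  have -> : 2 * ((q + 1) * a) * a = (q + 1) * (2 * (a * a)) by ring.
  by apply: ler_wpM2l; lra.
have qq : 2 * q <= q * q by apply: ler_wpM2r; lra.
case: a01 => [aE|a1].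
  by rewrite aE !(mulr0, mul0r, addr0, add0r); lra.
have aq' : 1 * q <= a * q by apply: ler_wpM2r; lra.
by lra.
Qed.

(** * Skew families, and full points or planes of a line class *)

Section FullInLineClass.
Variables (R : realFieldType) (F : finFieldType) (n : nat).
Local Notation subspace := {vspace 'rV[F]_n}.
Local Notation Q := (#|F|%:R : R).
Local Notation gn := (gnum Q).
Local Notation Q2 := (card_field_ge2 F R).
Variables (x : subspace -> R) (W Z : subspace) (k : nat) (Y : {set subspace}).
Hypotheses (WZ : (W <= Z)%VS) (kE : k = (\dim W + 2)%N).
Hypothesis ZE : \dim Z = (k + 2)%N.
Hypothesis xY : forall S, \dim S = k -> wt x S = (S \in Y)%:R.
Variable j : nat.
Hypothesis paramE : weight_param x W Z 1 = j%:R.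
Hypothesis j_small : (4 * j ^ 2 <= #|F|)%N.

Local Notation L := (lines W Z k Y).
Local Notation M := (meeting W Z k Y).

Lemma natr_card_le_sum (A : {set subspace}) (g : subspace -> R) :
  (forall S, 0 <= g S) -> (forall S, S \in A -> 1 <= g S) ->
  A \subset L -> #|A|%:R <= \sum_(S in L) g S.
Proof.
move=> g0 g1 /subsetP AL; rewrite -sum1_card natr_sum.
rewrite big_mkcond [leRHS]big_mkcond; apply: ler_sum => S _.
by case: ifP => [SA|_]; [rewrite AL ?g1|case: ifP].
Qed.

Definition skew_family (X : {set subspace}) : Prop :=
  X \subset L /\ {in X &, forall A B, A != B -> (A :&: B)%VS = W}.

(* Were there j + 1 pairwise skew lines, count the pairs (line of the family,
   line meeting it) and use d (3 - d) <= 2 for the number d of lines of the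
   family that a given line meets. *)
Lemma card_skew_family (X : {set subspace}) : skew_family X -> #|X| != j.+1.
Proof.
move=> [/subsetP XL Xskew]; apply/eqP => cX.
pose d (S : subspace) : R := \sum_(A in X) (S \in M A)%:R.
have dnat S : exists e : nat, d S = e%:R.
  by exists (\sum_(A in X) (S \in M A))%N; rewrite natr_sum.
have sum_card (A : {set subspace}) : A \subset L ->
    \sum_(S in L) (S \in A)%:R = #|A|%:R :> R.
  move=> /subsetP AL; rewrite -sum1_card natr_sum [LHS]big_mkcond [RHS]big_mkcond /=.
  apply: eq_bigr => S _; have [SA|] := boolP (S \in A); first by rewrite AL.
  by rewrite if_same.
have ML A : M A \subset L by apply/subsetP => S; rewrite in_meeting => /andP[].
have sumd : \sum_(S in L) d S = \sum_(A in X) #|M A|%:R.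
  by rewrite exchange_big /=; apply: eq_bigr => A _; exact: sum_card.
have sumdd : \sum_(S in L) d S * d S =
    \sum_(A in X) \sum_(B in X) #|M A :&: M B|%:R.
  transitivity (\sum_(S in L) \sum_(A in X) \sum_(B in X)
      ((S \in M A :&: M B)%:R : R)).
    apply: eq_bigr => S _; rewrite mulr_suml; apply: eq_bigr => A _.
    rewrite mulr_sumr; apply: eq_bigr => B _.
    by rewrite in_setI -natrM mulnb.
  rewrite exchange_big /=; apply: eq_bigr => A _; rewrite exchange_big /=.
  apply: eq_bigr => B _; apply: sum_card.
  by apply: subset_trans (ML A); exact: subsetIl.
have le2 : \sum_(S in L) (3 * d S - d S * d S) <= \sum_(S in L) 2.
  apply: ler_sum => S _; have [e ->] := dnat S.
  have h : 0 <= (e%:R - 1) * (e%:R - 2) :> R.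
    case: e => [|[|e]]; [lra|by rewrite subrr mul0r|].
    by rewrite -addn2 natrD; have e0 : 0 <= e%:R :> R by []; nra.
  have -> : 3 * e%:R - e%:R * e%:R = 2 - (e%:R - 1) * (e%:R - 2) :> R by ring.
  by rewrite gerBl; exact: h.
have ge : \sum_(A in X) (2 * ((Q + 1) * (j%:R + Q) - Q)
            - j%:R * (Q *+ 2 + j%:R)) <= \sum_(S in L) (3 * d S - d S * d S).
  (* For fixed [A] the diagonal term [B = A] reduces the coefficient 3 of [#|M A|] to 2; the other
     [j] terms are bounded by [common_meeting_le]. *)
  rewrite [leRHS]sumrB -[\sum_(S in L) 3 * _]mulr_sumr sumd sumdd mulr_sumr.
  rewrite -[leRHS]sumrB; apply: ler_sum => A AX.
  have MA := meeting_ge WZ kE ZE xY (XL _ AX); rewrite paramE in MA.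
  rewrite (bigD1 A) //= setIid.
  have : \sum_(B in X | B != A) #|M A :&: M B|%:R <= j%:R * (Q *+ 2 + j%:R).
    apply: (@le_trans _ _ (\sum_(B in X | B != A) (Q *+ 2 + j%:R))).
      apply: ler_sum => B /andP[BX BA]; rewrite -paramE.
      by apply: common_meeting_le; rewrite ?XL ?Xskew // eq_sym.
    rewrite sumr_const mulr_natl.
    suff -> : #|[pred B in X | B != A]| = j by [].
    have -> : #|[pred B in X | B != A]| = #|X :\ A|.
      by apply: eq_card => B; rewrite !inE andbC.
    by have := cardsD1 A X; rewrite AX cX add1n => -[].
  by move: MA; set a := #|_|%:R; set b := \sum_(_ in _ | _) _; lra.
have := le_trans ge le2.
rewrite !sumr_const cX -[_ *+ j.+1]mulr_natr -[_ *+ #|L|]mulr_natr.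
rewrite (card_lines WZ kE ZE xY) paramE gnum3 ?Q2 // -[j.+1%:R]natr1.
rewrite leNgt skew_count_contra ?Q2 //.
by rewrite -!natrM ler_nat; move: j_small; rewrite expnS expn1.
Qed.

(** Each [A] of the family forbids the lines through the point [S0 :&: A] and those in the plane
    [S0 + A], at most [2 (Q + 1) j] in all. Too few lines are forbidden to exhaust those meeting
    [S0], and any remaining one is skew to the family. *)
Lemma skew_extend (S0 : subspace) (X : {set subspace}) : S0 \in L ->
  (forall T, (W <= T)%VS -> (T <= S0)%VS -> (\dim T).+1 = k ->
     \sum_(S in interval k T Z) wt x S <= (Q + 1) * j%:R) ->
  (forall U, (S0 <= U)%VS -> (U <= Z)%VS -> \dim U = k.+1 ->
     \sum_(S in interval k W U) wt x S <= (Q + 1) * j%:R) ->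
  skew_family X -> X \subset M S0 :\ S0 -> (#|X| <= j)%N ->
  exists2 S, S \in M S0 :\ S0 & S \notin X /\ skew_family (S |: X).
Proof.
move=> L0 upb downb [XL Xskew] /subsetP XM cX.
have := L0; rewrite in_lines => /and4P[/eqP d0 W0 S0Z Y0].
pose bad (A S : subspace) : bool := (S0 :&: A <= S)%VS || (S <= S0 + A)%VS.
have XP A : A \in X -> [/\ A \in L, A != S0, \dim (S0 :&: A) = k.-1,
    \dim (S0 + A) = k.+1 & \dim A = k].
  move=> /XM; rewrite in_setD1 in_meeting => /and3P[AS0 LA capA].
  have := LA; rewrite in_lines => /and4P[/eqP dA WA AZ YA].
  have lt : (\dim (S0 :&: A) < k)%N by apply: dim_pairs; rewrite // eq_sym.
  have gt : (\dim W < \dim (S0 :&: A))%N.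
    rewrite ltnNge; apply: contra capA => le; apply/eqP/esym.
    by apply: eq_dim_subv; rewrite // subv_cap W0.
  have E : \dim (S0 :&: A) = k.-1 by move: lt gt; rewrite kE; dim_lia.
  split=> //; first by rewrite dA eqxx WA AZ.
  by have := dimv_sum_cap S0 A; rewrite E d0 dA kE; dim_lia.
have [S SM Sgood] : exists2 S, S \in M S0 :\ S0 & forall A, A \in X -> ~~ bad A S.
  suff /exists_inP[S SM /forall_inP SX] :
      [exists S in M S0 :\ S0, [forall A in X, ~~ bad A S]] by exists S.
  apply: contraT => /exists_inPn noS.
  (* If no line remains, every line meeting [S0] is [S0] or is forbidden by some [A]. *)
  have : #|M S0|%:R <= \sum_(S in L) ((S == S0)%:R +
      \sum_(A in X) (((S0 :&: A <= S) && (S <= Z))%VS%:R +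
                     ((W <= S) && (S <= S0 + A))%VS%:R) : R).
    apply: natr_card_le_sum => [S|S SM|]; last 2 first.
    - have := SM; rewrite in_meeting => /andP[]; rewrite in_lines.
      move=> /and4P[_ WS SZ _] _.
      have [->|SS0] := eqVneq S S0.
        by rewrite lerDl sumr_ge0 // => A _; rewrite addr_ge0.
      rewrite add0r; have : S \in M S0 :\ S0 by rewrite in_setD1 SS0.
      move=> /noS /forall_inPn[A AX]; rewrite negbK => bA.
      rewrite (bigD1 A) //= WS SZ !andbT /= -[leLHS]addr0 lerD //; last first.
        by rewrite sumr_ge0 // => B _; rewrite addr_ge0.
      rewrite -natrD ler1n lt0n addn_eq0 !eqb0 -negb_or negbK.
      exact: bA.
    - by apply/subsetP => S; rewrite in_meeting => /andP[].
    - by rewrite addr_ge0 ?sumr_ge0 // => A _; rewrite addr_ge0.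
  rewrite big_split /= [X in _ <= X + _](_ : _ = 1); last first.
    by rewrite (bigD1 S0) //= eqxx big1 ?addr0 // => S /andP[_ /negbTE->].
  rewrite exchange_big /=.
  have le : \sum_(A in X) \sum_(S in L) (((S0 :&: A <= S) && (S <= Z))%VS%:R +
      ((W <= S) && (S <= S0 + A))%VS%:R) <= \sum_(A in X) (2 * ((Q + 1) * j%:R)).
    apply: ler_sum => A AX; have [LA _ dcap dsum dA] := XP A AX.
    have := LA; rewrite in_lines => /and4P[_ WA AZ _].
    rewrite big_split /= mulr_natl mulr2n -!(sum_wt_card xY) ?subvv //; last 2 first.
    - by rewrite subv_add S0Z.
    - by rewrite subv_cap W0.
    apply: lerD.
      by apply: upb; rewrite ?subv_cap ?W0 ?capvSl // dcap kE addn2.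
    by apply: downb; rewrite ?addvSl ?subv_add ?S0Z.
  move=> h; have {le h} := le_trans h (lerD (lexx _) le).
  rewrite sumr_const -[_ *+ #|X|]mulr_natr leNgt skew_extend_contra ?Q2 //.
  - by case: (j) => [|i]; [left|right; rewrite ler1n].
  - by rewrite -!natrM ler_nat; move: j_small; rewrite expnS expn1.
  - by rewrite ler_nat.
  - by have := meeting_ge WZ kE ZE xY L0; rewrite paramE.
have := SM; rewrite in_setD1 in_meeting => /and3P[SS0 LS capS].
have := LS; rewrite in_lines => /and4P[/eqP dS WS SZ YS].
have dT : \dim (S0 :&: S) = k.-1.
  have lt : (\dim (S0 :&: S) < k)%N by apply: dim_pairs; rewrite // eq_sym.
  have gt : (\dim W < \dim (S0 :&: S))%N.
    rewrite ltnNge; apply: contra capS => le; apply/eqP/esym.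
    by apply: eq_dim_subv; rewrite // subv_cap W0.
  by move: lt gt; rewrite kE; dim_lia.
have Sskew A : A \in X -> (S :&: A)%VS = W.
  move=> AX; have := Sgood A AX; rewrite negb_or => /andP[bad1 bad2].
  have [LA _ dcap dsum dA] := XP A AX.
  have := LA; rewrite in_lines => /and4P[_ WA AZ _].
  apply/esym/eq_dim_subv; first by rewrite subv_cap WS.
  rewrite leqNgt; apply/negP => gt.
  (* If [S] met [A] on [S0], it would pass through [S0 :&: A]. If it met [A] off [S0], it would be
     spanned by its points on [S0] and [A], and so lie in [S0 + A]. *)
  have [R0|R0] := boolP (S :&: A <= S0)%VS.
    case/negP: bad1; rewrite -(_ : S :&: A = S0 :&: A)%VS ?capvSl //.
    apply: eq_dim_subv; first by rewrite subv_cap R0 capvSr.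
    by rewrite dcap kE addn2.
  case/negP: bad2; rewrite -[X in (X <= _)%VS](_ : S0 :&: S + S :&: A = S)%VS.
    by rewrite addvS ?capvSl ?capvSr.
  apply: eq_dim_subv; first by rewrite subv_add capvSr capvSl.
  rewrite dS kE addn2 -addn1 -[(\dim W).+1]/((\dim W).+2.-1) -addn2 -kE -dT addn1.
  rewrite ltnNge; apply: contra R0 => le.
  apply: subv_trans (addvSr (S0 :&: S) (S :&: A)) _.
  by rewrite -(eq_dim_subv (addvSl (S0 :&: S) (S :&: A)) le) capvSl.
exists S => //; split.
  apply/negP => SX; have := Sskew S SX; rewrite capvv => E.
  by move: dS; rewrite E kE addn2 => /eqP; rewrite ltn_eqF.
split; first by rewrite subUset sub1set LS.
move=> A B; rewrite !in_setU1 => /orP[/eqP->|AX] /orP[/eqP->|BX].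
- by rewrite eqxx.
- by move=> _; exact: Sskew.
- by move=> _; rewrite capvC; exact: Sskew.
- exact: Xskew.
Qed.

(** If neither existed, [up_bound] and [down_bound] would allow extending the empty skew family
    [j + 1] times by [skew_extend], contrary to [card_skew_family]. *)
Lemma full_in_line_class (S0 : subspace) : S0 \in L ->
  (exists T, [/\ (W <= T)%VS, (T <= S0)%VS, (\dim T).+1 = k &
     forall S, S \in interval k T Z -> S \in Y]) \/
  (exists U, [/\ (S0 <= U)%VS, (U <= Z)%VS, \dim U = k.+1 &
     forall S, S \in interval k W U -> S \in Y]).
Proof.
move=> L0; have := L0; rewrite in_lines => /and4P[/eqP d0 W0 S0Z Y0].
have [/exists_inP[T]|noT] :=
    boolP [exists T in interval k.-1 W S0, interval k T Z \subset Y].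
  rewrite in_interval => /and3P[/eqP dT WT TS] /subsetP TY.
  by left; exists T; split; rewrite // dT kE addn2.
have [/exists_inP[U]|noU] :=
    boolP [exists U in interval k.+1 S0 Z, interval k W U \subset Y].
  rewrite in_interval => /and3P[/eqP dU SU UZ] /subsetP UY.
  by right; exists U; split.
exfalso.
have upb T : (W <= T)%VS -> (T <= S0)%VS -> (\dim T).+1 = k ->
     \sum_(S in interval k T Z) wt x S <= (Q + 1) * j%:R.
  move=> WT TS dT; have TI : T \in interval k.-1 W S0.
    by rewrite in_interval WT TS -dT eqxx.
  move: noT => /exists_inPn/(_ T TI)/subsetPn[S SI SY].
  by rewrite -paramE -(gnum2 Q2); apply: (up_bound WZ kE ZE _ xY WT dT SI SY).
have downb U : (S0 <= U)%VS -> (U <= Z)%VS -> \dim U = k.+1 ->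
     \sum_(S in interval k W U) wt x S <= (Q + 1) * j%:R.
  move=> SU UZ dU; have UI : U \in interval k.+1 S0 Z.
    by rewrite in_interval SU UZ dU eqxx.
  move: noU => /exists_inPn/(_ U UI)/subsetPn[S SI SY].
  by rewrite -paramE -(gnum2 Q2); apply: (down_bound WZ kE ZE xY UZ dU SI SY).
suff : forall i, (i <= j.+1)%N -> exists X : {set subspace},
    [/\ skew_family X, X \subset M S0 :\ S0 & #|X| = i].
  move=> /(_ j.+1 (leqnn _))[X [Xs _ /eqP]].
  by rewrite (negbTE (card_skew_family Xs)).
elim=> [_|i IH ij].
  exists set0; rewrite cards0 sub0set; split => //; split; first exact: sub0set.
  by move=> A B; rewrite in_set0.
have [X [Xs XM cX]] := IH (ltnW ij).
have [|S SM [SX SXs]] := skew_extend L0 upb downb Xs XM; first by rewrite cX.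
exists (S |: X); split => //; first by rewrite subUset sub1set SM.
by rewrite cardsU1 SX cX.
Qed.

End FullInLineClass.

(** * Boolean degree 1 functions on k-spaces *)

Section BooleanClass.
Variables (R : realFieldType) (F : finFieldType) (n : nat).
Local Notation subspace := {vspace 'rV[F]_n}.
Local Notation Q := (#|F|%:R : R).
Local Notation gn := (gnum Q).
Local Notation gc := (gcount Q).
Local Notation Q2 := (card_field_ge2 F R).
Implicit Types (P S T U W Z : subspace).

Lemma dim_full : \dim ({:'rV[F]_n}%VS) = n.
Proof. by rewrite dimvf /dim /= mul1n. Qed.

Lemma wt0 (x : subspace -> R) : wt x 0%VS = 0.
Proof.
rewrite /wt big_pred0 // => P; apply/negP => /andP[].
by rewrite in_points subv0 => /eqP dP /eqP E; rewrite E dimv0 in dP.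
Qed.

Lemma wt_point (x : subspace -> R) P : P \in points F n -> wt x P = x P.
Proof.
move=> Pp; rewrite /wt (big_pred1 P) // => T /=.
apply/andP/eqP => [[Tp TP]|->]; last by [].
move: Tp Pp; rewrite !in_points => /eqP dT /eqP dP.
by rewrite (eq_dim_subv TP) // dT dP.
Qed.

Lemma interval_neq0 k W Z : (W <= Z)%VS -> (\dim W <= k <= \dim Z)%N ->
  exists S, S \in interval k W Z.
Proof.
move=> WZ /andP[Wk kZ]; apply/set0Pn; rewrite -card_gt0 -(ltr0n R).
by rewrite card_interval // gcount_gt0 // Q2.
Qed.

Variables (x : subspace -> R) (k : nat) (Y : {set subspace}).
Hypotheses (k_gt1 : (1 < k)%N) (kn : (k < n)%N).
Hypothesis Yk : Y \subset kspaces F n k.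
Hypothesis xY : forall S, \dim S = k -> wt x S = (S \in Y)%:R.

Local Notation s := (wt x fullv).

Definition full W := interval k W fullv \subset Y.

Lemma fullP W : reflect (forall S, \dim S = k -> (W <= S)%VS -> S \in Y) (full W).
Proof.
apply: (iffP subsetP) => [h S dS WS|h S].
  by apply: h; rewrite in_interval dS eqxx WS subvf.
by rewrite in_interval => /and3P[/eqP dS WS _]; exact: h.
Qed.

Lemma not_fullP W : ~~ full W -> exists S, [/\ \dim S = k, (W <= S)%VS & S \notin Y].
Proof.
move=> /subsetPn[S]; rewrite in_interval => /and3P[/eqP dS WS _] SY.
by exists S.
Qed.

Lemma card_class : #|Y|%:R = gc 1 k n * s.
Proof.
have -> : #|Y|%:R = \sum_(S in interval k 0%VS fullv) wt x S.
  rewrite -sum1_card natr_sum [LHS]big_mkcond [RHS]big_mkcond /=.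
  apply: eq_bigr => S _; rewrite in_interval sub0v subvf !andbT.
  case: eqP => [dS|dS]; first by rewrite xY //; case: (S \in Y).
  by case: ifP => // /(subsetP Yk); rewrite in_kspaces => /eqP.
rewrite sum_wt_interval ?sub0v ?dimv0 ?(ltnW k_gt1) //.
by rewrite wt0 mulr0 subr0 add0r dim_full.
Qed.

Lemma gcount1_gt0 : 0 < gc 1 k n.
Proof. by rewrite gcount_gt0 ?Q2 // ltnW. Qed.

Lemma param_ge0 : 0 <= s.
Proof.
have : 0 <= gc 1 k n * s by rewrite -card_class.
by rewrite pmulr_rge0 // gcount1_gt0.
Qed.

Lemma param_eq0 : (s == 0) = (Y == set0).
Proof.
rewrite -cards_eq0 -(pnatr_eq0 R) card_class mulf_eq0.
by rewrite (gt_eqF gcount1_gt0).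
Qed.

(** The factor [gn (k - \dim W)] clears the quotient of the two interval counts, leaving the common
    factor [gc (\dim W).+1 k n]. *)
Lemma sum_wt_through W : (\dim W < k)%N ->
  \sum_(S in interval k W fullv) wt x S * gn (k - \dim W) =
  gc (\dim W).+1 k n *
    (gn (n - \dim W) * wt x W + gn (k - \dim W) * (s - wt x W)).
Proof.
move=> wk; have g0 : gn (k - \dim W) != 0 by rewrite gnum_neq0 ?Q2 // subn_gt0.
rewrite -mulr_suml sum_wt_interval ?subvf // dim_full gcount_rec //.
by field; exact: g0.
Qed.

(** The value for which nonnegativity of the number of members through a point [P] reads
    [- mu <= x P]; the denominator is [gn (n - 1) - gn (k - 1)]. *)
Definition mu : R := s * gn k.-1 / (Q ^+ k.-1 * gn (n - k)).

Lemma mu_ge0 : 0 <= mu.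
Proof.
by apply: divr_ge0; apply: mulr_ge0; rewrite ?exprn_ge0 ?gnum_ge0 ?Q2 ?param_ge0.
Qed.

Lemma wt_point_ge P : P \in points F n -> - mu <= x P.
Proof.
move=> Pp; have := Pp; rewrite in_points => /eqP dP.
have d0 : 0 < Q ^+ k.-1 * gn (n - k).
  by rewrite mulr_gt0 ?expQ_gt0 ?gnum_gt0 ?Q2 // subn_gt0.
have := @sum_wt_through P; rewrite dP wt_point // => /(_ k_gt1) E.
have : 0 <= gc 2 k n * (gn (n - 1) * x P + gn (k - 1) * (s - x P)).
  rewrite -E; apply: sumr_ge0 => S; rewrite in_interval => /and3P[/eqP dS _ _].
  by rewrite mulr_ge0 ?gnum_ge0 ?Q2 // xY.
rewrite pmulr_rge0 ?gcount_gt0 ?Q2 ?(ltnW kn) //.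
have -> : (n - 1 = k.-1 + (n - k))%N by lia.
rewrite gnumD ?Q2 // subn1 => h.
rewrite /mu -mulNr ler_pdivrMr //.
by move: h d0; set a := Q ^+ _; lra.
Qed.

Lemma wt_diff_ge W S : (W <= S)%VS ->
  - ((gn (\dim S) - gn (\dim W)) * mu) <= wt x S - wt x W.
Proof.
move=> WS; rewrite /wt (sum_split_points x WS) addrAC subrr add0r.
rewrite -(card_points_diff R WS) -mulNr -sumrN mulr_suml.
apply: ler_sum => P /and3P[Pp _ _]; rewrite mulN1r; exact: wt_point_ge.
Qed.

Lemma wt_not_full_le W : ~~ full W -> wt x W <= (gn k - gn (\dim W)) * mu.
Proof.
move=> /not_fullP[S [dS WS SY]]; have := wt_diff_ge WS.
by rewrite xY // dS (negbTE SY) sub0r lerN2.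
Qed.

(** All k-spaces through [W] have weight 1, which turns [sum_wt_through] into a linear equation for
    [wt x W]. *)
Lemma wt_full W : (\dim W < k)%N -> full W ->
  wt x W * (gn (n - \dim W) - gn (k - \dim W)) =
  gn (n - \dim W) - gn (k - \dim W) * s.
Proof.
move=> wk /subsetP fW.
have c0 : gc (\dim W).+1 k n != 0.
  by rewrite lt0r_neq0 // gcount_gt0 ?Q2 // ltnW.
have := sum_wt_through wk.
rewrite (eq_bigr (fun=> gn (k - \dim W))); last first.
  move=> S SI; have := SI; rewrite in_interval => /and3P[/eqP dS _ _].
  by rewrite xY // fW // mul1r.
rewrite sumr_const -[_ *+ _]mulr_natl card_interval ?subvf ?(ltnW wk) //.
have g0 : gn (k - \dim W) != 0 by rewrite gnum_neq0 ?Q2 // subn_gt0.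
rewrite dim_full (_ : gc (\dim W) k n * _ = gc (\dim W).+1 k n * gn (n - \dim W)).
  by move=> /(mulfI c0); move: (gn _) (gn (k - _)) => a b E; lra.
by rewrite gcount_rec //; field; exact: g0.
Qed.

Lemma full_point_of_full W : 16 * s <= Q ^+ (n - 2 * k) -> (2 * k <= n)%N ->
  (0 < \dim W <= k)%N -> full W -> exists2 P, P \in points F n & full P.
Proof.
move=> s_small kn2; move: {2}(\dim W) (leqnn (\dim W)) => w; elim: w W => [|w IH] W.
  by rewrite leqn0 => /eqP->.
move=> dw /andP[W0 Wk] fW.
have [dW1|dW1] := eqVneq (\dim W) 1%N.
  by exists W => //; rewrite in_points dW1.
have [/exists_inP[W' W'I fW']|noW] :=
    boolP [exists W' in interval (\dim W).-1 0%VS W, full W'].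
  move: W'I; rewrite in_interval => /and3P[/eqP dW' _ _].
  apply: (IH W') => //; rewrite dW'; move: dw W0 Wk dW1; dim_lia.
exfalso.
have gn_shift a : (Q ^+ (n - 2 * k)) * gn a <= gn (n - 2 * k + a).
  by rewrite gnumD ?Q2 // lerDr gnum_ge0 ?Q2.
have s_shift a : 16 * (s * gn a) <= gn (n - 2 * k + a).
  apply: le_trans (gn_shift a); rewrite mulrA ler_wpM2r ?gnum_ge0 ?Q2 //.
(* Combines [(Q - 1) * gn k.-1 <= Q ^+ k.-1] with [16 * (s * gn k) <= gn (n - k)], which follows
   from the smallness of [s]. *)
have mu_small : (Q - 1) * (gn k * mu) <= 16^-1.
  have d0 : 0 < Q ^+ k.-1 * gn (n - k).
    by rewrite mulr_gt0 ?expQ_gt0 ?gnum_gt0 ?Q2 // subn_gt0.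
  have h1 : (Q - 1) * gn k.-1 <= Q ^+ k.-1.
    by rewrite /gnum mulrC divfK ?base_subr1_neq0 ?Q2 // gerBl.
  have h2 := s_shift k; rewrite (_ : n - 2 * k + k = n - k)%N in h2; last by lia.
  rewrite /mu (_ : _ * (_ * _) = (Q - 1) * gn k.-1 * (s * gn k) /
      (Q ^+ k.-1 * gn (n - k))); last by rewrite -!mulrA; congr (_ * _); ring.
  rewrite ler_pdivrMr // [leRHS]mulrCA; apply: ler_pM => //.
  - by rewrite mulr_ge0 // ?gnum_ge0 ?Q2 // subr_ge0 (le_trans _ Q2) // ler1n.
  - by rewrite mulr_ge0 // ?gnum_ge0 ?Q2 // param_ge0.
  - by rewrite ler_pdivlMl.
(* Each point of [W] lies in [gn w1] of the [gn w1.+1] hyperplanes of [W], none of which is full.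
   The 3 comes from [gn w1.+1 <= 3 (Q - 1) gn w1]. *)
have wtW : wt x W <= 3 / 16.
  set w1 := (\dim W).-1.
  have w1S : \dim W = w1.+1 by rewrite prednK.
  have w1_gt0 : (0 < w1)%N by move: dW1; rewrite w1S; case: (w1).
  have g1 : 1 <= gn w1 by have := le_gnum Q2 w1_gt0; rewrite gnum1 ?Q2.
  have : gn w1 * wt x W <= gn w1.+1 * (gn k * mu).
    have := @sum_wt_interval _ _ R x w1 0%VS W (sub0v _).
    rewrite dimv0 wt0 mulr0 add0r subr0 w1S gcount_hyper ?Q2 // subn1 => /(_ w1_gt0) <-.
    rewrite (_ : gn _ = \sum_(W' in interval w1 0%VS W) 1); last first.
      rewrite sumr_const card_interval ?sub0v ?dimv0 // w1S gcount_hyper ?Q2 //.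
    rewrite mulr_suml; apply: ler_sum => W' W'I; rewrite mul1r.
    have := noW => /exists_inPn/(_ W' W'I)/wt_not_full_le h.
    apply: le_trans h _; rewrite ler_wpM2r ?mu_ge0 // gerBl gnum_ge0 ?Q2 //.
  rewrite gnumS ?Q2 //; move: mu_small g1 Q2.
  have : 0 <= gn k * mu by rewrite mulr_ge0 ?gnum_ge0 ?Q2 ?mu_ge0.
  move: Q (gn k * mu) (gn w1) (wt x W) => q m g t m0 m1 g1 q2 h.
  have : (q * g + 1) * m <= (3 * (q - 1)) * g * m.
    have qg : 0 <= (q - 2) * g by apply: mulr_ge0; lra.
    by apply: ler_wpM2r => //; lra.
  have : g * ((q - 1) * m) <= g * 16^-1 by apply: ler_wpM2l; lra.
  move=> h1 h2; rewrite -(@ler_pM2l _ g); last lra.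
  lra.
have [wk|wk] := ltnP (\dim W) k; last first.
  have dW : \dim W = k by apply/eqP; rewrite eqn_leq Wk.
  by have := wtW; rewrite xY // (elimT (fullP W) fW W) // mulr1n; lra.
(* In [wt_full] the term with [s] is at most a sixteenth of [gn (n - \dim W)], which forces a weight
   above [3 / 16]. *)
have := wt_full wk fW.
have : gn (k - \dim W) <= gn (n - \dim W).
  by rewrite le_gnum ?Q2 // leq_sub2r // ltnW.
have : 16 * (s * gn (k - \dim W)) <= gn (n - \dim W).
  apply: le_trans (s_shift _) _; rewrite le_gnum ?Q2 //.
  by move: Wk kn2; dim_lia.
have : 0 < gn (n - \dim W).
  by rewrite gnum_gt0 ?Q2 // subn_gt0 (leq_trans wk) // ltnW.
have := gnum_ge0 Q2 (k - \dim W); have := wtW.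
move: (gn _) (gn (k - _)) (wt x W) => a b t t3 b0 a0 bs ab E.
have : t * (a - b) <= 3 / 16 * (a - b) by rewrite ler_wpM2r // subr_ge0.
by lra.
Qed.

End BooleanClass.

(** * Dimension n = 2k *)

Section HalfDimension.
Variables (R : realFieldType) (F : finFieldType) (n : nat).
Local Notation subspace := {vspace 'rV[F]_n}.
Local Notation Q := (#|F|%:R : R).
Local Notation gn := (gnum Q).
Local Notation gc := (gcount Q).
Local Notation Q2 := (card_field_ge2 F R).
Implicit Types (P S T U W Z : subspace).

Lemma gnum_nat a : exists m : nat, gn a = m%:R.
Proof.
elim: a => [|a [m IH]]; first by exists 0%N; rewrite gnum0.
by exists (#|F| * m + 1)%N; rewrite gnumS ?Q2 // IH natrD natrM.
Qed.

Variables (x : subspace -> R) (k : nat) (Y : {set subspace}).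
Hypothesis k_gt1 : (1 < k)%N.
Hypothesis xY : forall S, \dim S = k -> wt x S = (S \in Y)%:R.

Lemma sum_wt_nat W Z : exists m : nat, \sum_(S in interval k W Z) wt x S = m%:R.
Proof.
exists (\sum_(S in interval k W Z) (S \in Y))%N; rewrite natr_sum.
by apply: eq_bigr => S; rewrite in_interval => /and3P[/eqP dS _ _]; rewrite xY.
Qed.

(** For any flag [T < S < U] inside the interval, [sum_up_down] writes the parameter as a difference
    of natural numbers. *)
Lemma weight_param_nat W Z d S : (W <= Z)%VS -> k = (\dim W + d.+1)%N ->
  \dim Z = (k + d.+1)%N -> S \in interval k W Z -> 0 <= weight_param x W Z d ->
  exists j : nat, weight_param x W Z d = j%:R.
Proof.
move=> WZ kE ZE; rewrite in_interval => /and3P[/eqP dS WS SZ] p0.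
have [T] : exists T, T \in interval k.-1 W S.
  by apply: (interval_neq0 R WS); rewrite dS leq_pred kE addnS leq_addr.
rewrite in_interval => /and3P[/eqP dT WT TS].
have [U] : exists U, U \in interval k.+1 S Z.
  by apply: (interval_neq0 R SZ); rewrite dS leqnSn ZE addnS ltnS leq_addr.
rewrite in_interval => /and3P[/eqP dU SU UZ].
have := sum_up_down x WZ kE ZE WT (subv_trans TS SU) UZ.
rewrite dT prednK ?(ltnW k_gt1) // => /(_ erefl dU).
have [a ->] := sum_wt_nat T Z; have [b ->] := sum_wt_nat W U.
have [c ->] := sum_wt_nat T U; have [g ->] := gnum_nat d.+1.
rewrite -natrD -natrM => E; exists (a + b - g * c)%N.
have E' : weight_param x W Z d = (a + b)%:R - (g * c)%:R by rewrite E addrAC subrr add0r.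
by rewrite natrB // -(ler_nat R) -subr_ge0 -E'.
Qed.

Hypothesis nE : n = (k + k)%N.
Hypothesis Yk : Y \subset kspaces F n k.
Local Notation s := (wt x fullv).
Hypothesis s_ge1 : 1 <= s.
Hypothesis s_small : 64 * (s * s) <= Q.

Local Notation full := (full k Y).
Definition full_below U := interval k 0%VS U \subset Y.

Lemma s_le : 64 * s <= Q.
Proof.
apply: le_trans s_small; rewrite ler_wpM2l //.
by rewrite -[leLHS]mul1r ler_wpM2r // (le_trans ler01).
Qed.

Let kE0 : k = (\dim (0%VS : subspace) + k.-1.+1)%N.
Proof. by rewrite dimv0 add0n prednK // ltnW. Qed.

Let ZE0 : \dim ({:'rV[F]_n}%VS) = (k + k.-1.+1)%N.
Proof. by rewrite dim_full nE prednK // ltnW. Qed.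

Let k1_gt0 : (0 < k.-1)%N.
Proof. by case: k k_gt1 => [|[]]. Qed.

Let kS : k.-1.+1 = k.
Proof. by rewrite prednK // ltnW. Qed.

Lemma weight_param_full : weight_param x 0%VS fullv k.-1 = s.
Proof. by rewrite /weight_param wt0 mulr0 addr0. Qed.

Lemma up_not_full T : (\dim T).+1 = k -> ~~ full T ->
  \sum_(S in interval k T fullv) wt x S <= gn k * s.
Proof.
move=> dT /subsetPn[S SI SY]; have := up_bound (sub0v _) kE0 ZE0 k1_gt0 xY (sub0v _) dT SI SY.
by rewrite weight_param_full kS.
Qed.

Lemma down_not_full U : \dim U = k.+1 -> ~~ full_below U ->
  \sum_(S in interval k 0%VS U) wt x S <= gn k * s.
Proof.
move=> dU /subsetPn[S SI SY]; have := down_bound (sub0v _) kE0 ZE0 xY (subvf _) dU SI SY.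
by rewrite weight_param_full kS.
Qed.

Lemma sum_full W Z : interval k W Z \subset Y ->
  \sum_(S in interval k W Z) wt x S = #|interval k W Z|%:R.
Proof.
move=> /subsetP WZY; rewrite -sum1_card natr_sum; apply: eq_bigr => S SI.
by move: (SI); rewrite in_interval => /and3P[/eqP dS _ _]; rewrite xY // WZY.
Qed.

Lemma card_pencil T U : (T <= U)%VS -> (\dim T).+1 = k -> \dim U = k.+1 ->
  #|interval k T U|%:R = Q + 1.
Proof.
move=> TU dT dU; rewrite card_interval //; last by rewrite -dT.
by rewrite -dT gcountS ?Q2 // dU -dT subSn // subSnn gnum2 ?Q2.
Qed.

Lemma up_down_full T U : (T <= U)%VS -> (\dim T).+1 = k -> \dim U = k.+1 ->
  interval k T U \subset Y ->
  \sum_(S in interval k T fullv) wt x S + \sum_(S in interval k 0%VS U) wt x S =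
  gn k * (Q + 1) + s.
Proof.
move=> TU dT dU fTU.
rewrite (sum_up_down x (sub0v _) kE0 ZE0 (sub0v _) TU (subvf _) dT dU).
by rewrite weight_param_full kS sum_full // card_pencil.
Qed.

(** If neither were full, the two sums of [up_down_full] would be at most [gn k * s] each. This is
    too little, because [s] is far below [Q]. *)
Lemma pencil_full T U : (T <= U)%VS -> (\dim T).+1 = k -> \dim U = k.+1 ->
  interval k T U \subset Y -> full T || full_below U.
Proof.
move=> TU dT dU fTU; apply: contraT; rewrite negb_or => /andP[fT fU].
have := up_down_full TU dT dU fTU.
have := up_not_full dT fT; have := down_not_full dU fU.
have := s_le; have := gnum_gt0 Q2 (ltnW k_gt1).
move: s_ge1 => s1; move: (gn k) => g g0 sQ a b E.
have : g * (64 * s) <= g * Q by rewrite ler_wpM2l // ltW.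
have : 0 <= g * s by rewrite mulr_ge0 // ltW // (lt_le_trans _ s1).
by lra.
Qed.

(** Both sums of [up_down_full] would equal [gn k.+1], so that [s = gn k * (Q - 1) + 2], which
    exceeds [Q]. *)
Lemma full_excl T U : (T <= U)%VS -> (\dim T).+1 = k -> \dim U = k.+1 ->
  full T -> full_below U -> False.
Proof.
move=> TU dT dU fT fU.
have fTU : interval k T U \subset Y.
  apply: subset_trans fT; apply/subsetP => S; rewrite !in_interval.
  by move=> /and3P[-> -> _]; exact: subvf.
have := up_down_full TU dT dU fTU; rewrite !sum_full //.
rewrite card_interval ?subvf //; last by rewrite -dT.
rewrite card_interval ?sub0v //; last by rewrite dimv0.
rewrite dimv0 dU gcount_hyper ?Q2 // subn0 dim_full.
have -> : gc (\dim T) k n = gn k.+1.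
  rewrite -[X in gc _ X _]dT gcountS ?Q2 //; congr gn.
  by rewrite [X in (X - _)%N]nE -dT; dim_lia.
rewrite gnumS ?Q2 //; have := s_le; have := Q2; have := s_ge1.
have : 1 <= gn k by have := le_gnum Q2 (ltnW k_gt1); rewrite gnum1 ?Q2.
move: s => t; move: Q (gn k) => q g g1 t1 q2 tq E.
have : 0 <= (g - 1) * (q - 1) by apply: mulr_ge0; lra.
by lra.
Qed.

Let kn : (k < n)%N.
Proof. by rewrite nE -[X in (X < _)%N]addn0 ltn_add2l ltnW. Qed.

Local Notation m := (mu x k).

Lemma mu_small : gn k * m <= 2 * (s / Q) /\ Q ^+ k.-1 * m <= s / Q.
Proof.
have Q0 : 0 < Q by rewrite (lt_le_trans _ Q2) // ltr0n.
have P0 : 0 < Q ^+ k.-1 by rewrite exprn_gt0.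
have g0 : 0 < gn k by rewrite gnum_gt0 ?Q2 // ltnW.
have nk : (n - k = k)%N by rewrite [X in (X - _)%N]nE addnK.
have s0 : 0 <= s by rewrite (le_trans ler01).
have gg : Q * gn k.-1 <= gn k by rewrite -[in leRHS]kS gnumS ?Q2 // lerDl.
have gP : (Q - 1) * gn k.-1 <= Q ^+ k.-1.
  by rewrite /gnum mulrC divfK ?base_subr1_neq0 ?Q2 // gerBl.
rewrite /mu nk; split.
  rewrite (_ : _ * _ = s * (gn k.-1 / Q ^+ k.-1)); last first.
    by field; rewrite !gt_eqF.
  rewrite [leRHS]mulrCA ler_wpM2l // ler_pdivrMr // mulrAC ler_pdivlMr //.
  have := gnum_ge0 Q2 k.-1; move: gP Q2; move: Q (gn k.-1) => q g; move: (_ ^+ _) => a.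
  move=> h q2 g1; have : 0 <= (q - 2) * g by apply: mulr_ge0; lra.
  by lra.
rewrite (_ : _ * _ = s * (gn k.-1 / gn k)); last by field; rewrite !gt_eqF.
by rewrite ler_wpM2l // ler_pdivrMr // ler_pdivlMl.
Qed.

(* Every full hyperplane of S carries almost all of the weight of S, so with
   many full hyperplanes the weight concentrates on a point common to most of
   them. *)
Lemma full_point_of_many S (TT : {set subspace}) : (2 < k)%N -> S \in Y ->
  (forall T, T \in TT -> [/\ (\dim T).+1 = k, (T <= S)%VS & full T]) ->
  gn k <= 4 * (Q + 1) * #|TT|%:R ->
  exists2 P, P \in points F n & full P.
Proof.
move=> k_gt2 SY TTP TTbig.
have dS : \dim S = k by move: (subsetP Yk _ SY); rewrite in_kspaces => /eqP.
have [mk mQ] := mu_small; set eps := 2 * (s / Q).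
have Q0 : 0 < Q by rewrite (lt_le_trans _ Q2) // ltr0n.
have eps_small : 32 * eps <= 1.
  by rewrite /eps !mulrA ler_pdivrMr // mul1r; have := s_le; lra.
have m0 : 0 <= m := mu_ge0 k_gt1 kn Yk xY.
have g1 : 1 <= gn k by have := le_gnum Q2 (ltnW k_gt1); rewrite gnum1 ?Q2.
have m_eps : m <= eps by apply: le_trans mk; rewrite ler_peMl.
(* Shifting by [mu] makes the point weights nonnegative, so that averaging arguments apply. *)
pose y P := x P + m.
have y0 P : P \in points F n -> 0 <= y P.
  by move=> /(wt_point_ge k_gt1 kn Yk xY) h; rewrite /y -lerBlDr sub0r.
have sumy : 1 <= \sum_(P in points F n | (P <= S)%VS) y P.
  rewrite big_split /= -/(wt x S) xY // SY lerDl.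
  by apply: sumr_ge0.
(* Outside a full [T], the original weight [1 - wt x T] and the total shift [Q ^+ k.-1 * m] are each
   at most [s / Q]; hence the 2 in [eps]. *)
have sumyT T : T \in TT ->
    \sum_(P in points F n | (P <= S)%VS && ~~ (P <= T)%VS) y P <= eps.
  move=> /TTP[dT TS fT].
  have sumx : \sum_(P in points F n | (P <= S)%VS && ~~ (P <= T)%VS) x P =
      1 - wt x T.
    have : wt x S = wt x T + _ := sum_split_points x TS.
    by rewrite (xY dS) SY mulr1n => E; lra.
  have summ : \sum_(P in points F n | (P <= S)%VS && ~~ (P <= T)%VS) m =
      Q ^+ k.-1 * m.
    rewrite -[m]mul1r -mulr_suml card_points_diff // dS -dT /= -addn1.
    by rewrite gnumD ?Q2 // gnum1 ?Q2 // mulr1 addrAC subrr add0r !mul1r.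
  rewrite big_split /= sumx summ /eps mulr_natl mulr2n lerD //.
  have Tk : (\dim T < k)%N by rewrite -dT.
  have := wt_full kn xY Tk fT.
  have -> : (n - \dim T = k.+1)%N by rewrite [X in (X - _)%N]nE -dT; dim_lia.
  have -> : (k - \dim T = 1)%N by rewrite -dT; dim_lia.
  rewrite gnumS ?Q2 // gnum1 ?Q2 // addrK mul1r => E.
  rewrite ler_pdivlMr //; apply: (@le_trans _ _ ((1 - wt x T) * (Q * gn k))).
    have E' : (1 - wt x T) * (Q * gn k) = s - 1 by rewrite mulrBl E; ring.
    have T0 : 0 <= 1 - wt x T.
      have : 0 <= (1 - wt x T) * (Q * gn k) by rewrite E' subr_ge0.
      by rewrite pmulr_lge0 // mulr_gt0 // (lt_le_trans _ g1).
    by rewrite ler_wpM2l // ler_peMr // ltW.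
  by rewrite mulrBl E; lra.
(* The number of members of [TT] that miss [P]. *)
pose a P : R := \sum_(T in TT) (~~ (P <= T)%VS)%:R.
set N : R := #|TT|%:R.
have N0 : 0 < N.
  have : 0 < 4 * (Q + 1) * N by apply: lt_le_trans TTbig; apply: lt_le_trans g1.
  by rewrite pmulr_rgt0 // mulr_gt0 // addr_gt0.
have sumya : \sum_(P in points F n | (P <= S)%VS) y P * a P <= N * eps.
  under eq_bigr do rewrite mulr_sumr.
  rewrite exchange_big /= /N -sum1_card natr_sum mulr_suml.
  apply: ler_sum => T TI; rewrite mul1r; apply: le_trans (sumyT T TI).
  rewrite [leLHS]big_mkcond [leRHS]big_mkcond; apply: ler_sum => P _ /=.
  rewrite andbA; case: ifP => //= _; case: (P <= T)%VS => /=.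
    by rewrite mulr0.
  by rewrite mulr1.
(* The average of [a] with weights [y] is at most [N * eps], hence at most [N / 32], so some point
   is missed by at most a quarter of [TT]. *)
have [P0 [P0p P0S aP0]] : exists P0, [/\ P0 \in points F n, (P0 <= S)%VS & a P0 <= N / 4].
  case: (boolP [exists P, [&& P \in points F n, (P <= S)%VS & a P <= N / 4]]).
    by move=> /existsP[P /and3P[? ? ?]]; exists P.
  move=> /existsPn noP; exfalso.
  have : (\sum_(P in points F n | (P <= S)%VS) y P) * (N / 4) <= N * eps.
    apply: le_trans sumya; rewrite mulr_suml; apply: ler_sum => P /andP[Pp PS].
    rewrite ler_wpM2l ?y0 //; have := noP P; rewrite Pp PS /= -ltNge.
    exact: ltW.
  have : 1 * (N / 4) <= (\sum_(P in points F n | (P <= S)%VS) y P) * (N / 4).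
    by rewrite ler_wpM2r // divr_ge0 // ltW.
  have : N * (32 * eps) <= N * 1 by rewrite ler_wpM2l // ltW.
  by move: N0; lra.
(* At most [gn k.-2] hyperplanes of [S] contain two given points; by the size of [TT] this is at
   most a quarter of [N]. *)
have gN : gn k.-2 <= N / 4.
  have k2E : k = (2 + k.-2)%N by rewrite -[LHS](subnKC (ltnW k_gt2)) subn2.
  have : Q ^+ 2 * gn k.-2 <= 4 * (Q + 1) * N.
    by apply: le_trans TTbig; rewrite [in leRHS]k2E gnumD ?Q2 // lerDr gnum_ge0 ?Q2.
  have Q64 : 64 <= Q by have := s_le; move: s_ge1; lra.
  have g0 := gnum_ge0 Q2 k.-2.
  have : 16 * (Q + 1) * gn k.-2 <= Q ^+ 2 * gn k.-2.
    rewrite ler_wpM2r // expr2; have : 64 * Q <= Q * Q by rewrite ler_wpM2r // ltW.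
    by lra.
  move=> h1 h2; have : (Q + 1) * (4 * gn k.-2) <= (Q + 1) * N by lra.
  by rewrite ler_pM2l ?addr_gt0 //; lra.
(* A member of [TT] through [P] either contains [P0] as well or misses [P0]; each case accounts for
   at most [N / 4] members. *)
have aP P : P \in points F n -> (P <= S)%VS -> P != P0 -> N / 2 <= a P.
  move=> Pp PS PP0.
  have dPP : \dim (P + P0) = 2%N.
    have dP : \dim P = 1%N by move: Pp; rewrite in_points => /eqP.
    rewrite dim_add_point ?dP //; apply: contra PP0 => le; apply/eqP/esym.
    by apply: eq_dim_subv le _; rewrite dP; move: P0p; rewrite in_points => /eqP->.
  have E : N - a P = \sum_(T in TT) ((P <= T)%VS)%:R.
    rewrite /N -sum1_card natr_sum -sumrB; apply: eq_bigr => T _.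
    by case: (P <= T)%VS; rewrite ?subr0 ?subrr.
  have : N - a P <= gn k.-2 + a P0.
    have -> : gn k.-2 = #|interval k.-1 (P + P0) S|%:R.
      rewrite card_interval ?subv_add ?PS //; last by rewrite dPP; case: (k) k_gt2 => [|[]].
      rewrite dPP dS -[X in gc _ _ X]kS gcount_hyper ?Q2 //; last by case: (k) k_gt2 => [|[]].
      by rewrite kS subn2.
    rewrite E -sum1_card natr_sum.
    have -> : \sum_(T in interval k.-1 (P + P0) S) 1%:R =
              \sum_(T in interval k.-1 (P + P0) S) (1 : R) by [].
    apply: (@le_trans _ _ (\sum_(T in TT) ((T \in interval k.-1 (P + P0) S)%:R
         + (~~ (P0 <= T)%VS)%:R))).
      apply: ler_sum => T TI; have [dT TS _] := TTP T TI.
      rewrite in_interval TS -dT eqxx andbT subv_add /=.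
      by case: (P <= T)%VS; case: (P0 <= T)%VS; rewrite /= -?natrD ?ler_nat.
    rewrite big_split /= lerD2r [leLHS]big_mkcond [leRHS]big_mkcond.
    by apply: ler_sum => T _; case: (T \in TT) => /=; case: (T \in interval _ _ _).
  by move: aP0 gN; lra.
exists P0 => //; apply: contraT => nf.
(* The other points are each missed by half of [TT], so their shifted weights sum to at most
   [2 * eps]. A point that is not full has shifted weight at most [gn k * m], hence at most
   [eps]. *)
have yP0 : 1 - 2 * eps <= y P0.
  have : (\sum_(P in points F n | (P <= S)%VS && (P != P0)) y P) * (N / 2) <= N * eps.
    apply: le_trans sumya; rewrite mulr_suml.
    rewrite [leRHS](bigD1 P0) /= ?P0p //.
    rewrite -[leLHS]add0r lerD //.
      by rewrite mulr_ge0 ?y0 // sumr_ge0.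
    rewrite (eq_bigl (fun P => (P \in points F n) && (P <= S)%VS && (P != P0))); last first.
      by move=> P; rewrite andbA.
    apply: ler_sum => P /andP[/andP[Pp PS] PP0].
    by rewrite ler_wpM2l ?y0 // aP.
  move: sumy; rewrite (bigD1 P0) /= ?P0p //.
  rewrite (eq_bigl (fun P => (P \in points F n) && ((P <= S)%VS && (P != P0)))); last first.
    by move=> P; rewrite andbA.
  set b := \sum_(_ | _) _ => h1 h2.
  have : N * (b / 2) <= N * eps by lra.
  by rewrite ler_pM2l // => h3; lra.
have := wt_not_full_le k_gt1 kn Yk xY nf.
have -> : \dim P0 = 1%N by move: P0p; rewrite in_points => /eqP.
rewrite wt_point // gnum1 ?Q2 // mulrBl mul1r => h.
have mk_eps : gn k * m <= eps by exact: mk.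
by exfalso; move: yP0; rewrite /y; lra.
Qed.

(** Fullness of a point or plane within the 3-space puts a whole pencil [T < S' < U] into [Y]. Then
    [pencil_full] makes [T] or [U] full in the whole space, and [U] is excluded by assumption. *)
Lemma full_of_small_line_class S W Z (j : nat) : S \in Y ->
  (forall U, (S <= U)%VS -> \dim U = k.+1 -> ~~ full_below U) ->
  (W <= S)%VS -> (S <= Z)%VS -> k = (\dim W + 2)%N -> \dim Z = (k + 2)%N ->
  weight_param x W Z 1 = j%:R -> (4 * j ^ 2 <= #|F|)%N ->
  exists2 T, T \in interval k.-1 W S & full T.
Proof.
move=> SY noU WS SZ kE ZE jE j_small.
have dS : \dim S = k by move: (subsetP Yk _ SY); rewrite in_kspaces => /eqP.
have SL : S \in lines W Z k Y by rewrite in_lines dS eqxx WS SZ.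
have WZ := subv_trans WS SZ.
have [[T [WT TS dT fT]]|[U [SU UZ dU fU]]] :=
  full_in_line_class WZ kE ZE xY jE j_small SL.
- have [U] : exists U, U \in interval k.+1 S Z.
    by apply: (interval_neq0 R SZ); rewrite dS leqnSn ZE addn2 leqnSn.
  rewrite in_interval => /and3P[/eqP dU SU UZ].
  exists T; first by rewrite in_interval -dT eqxx WT.
  have : full T || full_below U.
    apply: pencil_full (subv_trans TS SU) dT dU _.
    apply/subsetP => S'; rewrite in_interval => /and3P[dS' TS' S'U].
    by apply: fT; rewrite in_interval dS' TS' (subv_trans S'U).
  by rewrite (negbTE (noU U SU dU)) orbF.
have [T] : exists T, T \in interval k.-1 W S.
  by apply: (interval_neq0 R WS); rewrite dS leq_pred kE addn2 leqnSn.
move=> TI; exists T => //; move: TI; rewrite in_interval => /and3P[/eqP dT WT TS].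
have dT' : (\dim T).+1 = k by rewrite dT.
have : full T || full_below U.
  apply: pencil_full (subv_trans TS SU) dT' dU _.
  apply/subsetP => S'; rewrite in_interval => /and3P[dS' TS' S'U].
  by apply: fU; rewrite in_interval dS' S'U (subv_trans WT).
by rewrite (negbTE (noU U SU dU)) orbF.
Qed.

(** [S] itself is a member between [W] and [Z], so the count [gn 3 * weight_param] is positive. *)
Lemma weight_param_pos S W Z : S \in Y ->
  (W <= S)%VS -> (S <= Z)%VS -> k = (\dim W + 2)%N -> \dim Z = (k + 2)%N ->
  exists j : nat, weight_param x W Z 1 = j%:R /\ (0 < j)%N.
Proof.
move=> SY WS SZ kE ZE.
have dS : \dim S = k by move: (subsetP Yk _ SY); rewrite in_kspaces => /eqP.
have WZ := subv_trans WS SZ.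
have p0 : 0 < weight_param x W Z 1.
  have := card_lines WZ kE ZE xY; rewrite -(pmulr_rgt0 _ (gnum_gt0 Q2 (ltn0Sn 2))).
  move=> <-; rewrite ltr0n card_gt0; apply/set0Pn; exists S.
  by rewrite in_lines dS eqxx WS SZ.
have SI : S \in interval k W Z by rewrite in_interval dS eqxx WS SZ.
have [j jE] := weight_param_nat WZ kE ZE SI (ltW p0).
by exists j; split => //; move: p0; rewrite jE ltr0n.
Qed.

Let Q64 : 64 <= Q.
Proof. by have := s_le; move: s_ge1; lra. Qed.

(* On average weight_param x W Z 1 is about 2 over the pairs (W, Z) around S,
   so that it is at most 2 for many W, after fixing a good Z. *)
Lemma many_full S : (2 < k)%N -> S \in Y ->
  (forall U, (S <= U)%VS -> \dim U = k.+1 -> ~~ full_below U) ->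
  gn k <= 4 * (Q + 1) * #|[set T in interval k.-1 0%VS S | full T]|%:R.
Proof.
move=> k_gt2 SY noU.
have dS : \dim S = k by move: (subsetP Yk _ SY); rewrite in_kspaces => /eqP.
have [h hE] : exists h, k = h.+3 by case: (k) k_gt2 => [|[|[|h]]] // _; exists h.
have Q1 : 0 < Q + 1 by apply: addr_gt0; rewrite // (lt_le_trans _ Q2).
have g1_gt0 : 0 < gn k.-1 by rewrite gnum_gt0 ?Q2.
have gk : gn k = Q + 1 + Q ^+ 2 * gn k.-2.
  by rewrite hE -[h.+3]/(2 + h.+1)%N gnumD ?Q2 // gnum2 ?Q2.
have gk_ge : Q * (Q + 1) <= gn k.
  rewrite gk; have : 1 <= gn k.-2.
    by have := @le_gnum _ _ Q2 1 k.-2; rewrite gnum1 ?Q2 // hE; apply.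
  move: Q64 => q64 g; have : Q ^+ 2 * 1 <= Q ^+ 2 * gn k.-2 by rewrite ler_wpM2l // sqr_ge0.
  by rewrite expr2; lra.
set D := gn k * gn k.-1 / (Q + 1).
have D0 : 0 < D by rewrite divr_gt0 // mulr_gt0 // gnum_gt0 ?Q2 // ltnW.
have nk : (n - k = k)%N by rewrite [X in (X - _)%N]nE addnK.
have nk1 : (n - k.+1 = k.-1)%N by rewrite subnS nk.
(* The average of [wt x Z - 1] over all [Z] is [(s - 1) (Q + 1) / gn k], below [8^-1] because
   [gn k >= Q (Q + 1)] and [s] is small against [Q]. *)
have [Z ZI wtZ] : exists2 Z, Z \in interval k.+2 S fullv & wt x Z - 1 <= 8^-1.
  case: (boolP [exists Z in interval k.+2 S fullv, wt x Z - 1 <= 8^-1]).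
    by move=> /exists_inP.
  move=> /exists_inPn noZ; exfalso.
  have : \sum_(Z in interval k.+2 S fullv) (8^-1 : R) <=
         \sum_(Z in interval k.+2 S fullv) (wt x Z - 1).
    by apply: ler_sum => Z /noZ; rewrite -ltNge => /ltW.
  have kn2 : (k.+2 <= n)%N by rewrite [X in (_ <= X)%N]nE -[k.+2]addn2 leq_add2l.
  have kk2 : (k <= k.+2)%N := leqW (leqnSn k).
  rewrite sumrB sum_wt_interval ?subvf ?dS // !sumr_const.
  rewrite -[8^-1 *+ _]mulr_natr card_interval ?subvf ?dS //.
  rewrite dim_full gcountSS ?Q2 // gcountS ?Q2 // nk nk1 (xY dS) SY -/D mulr1n mulr1.
  rewrite addrAC subrr add0r => h0.
  have h1 : gn k <= 8 * ((s - 1) * (Q + 1)).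
    rewrite -(@ler_pM2r _ (gn k.-1)) //.
    have <- : D * (Q + 1) = gn k * gn k.-1 by rewrite divfK // gt_eqF.
    have : (Q + 1) * (8^-1 * D) <= (Q + 1) * (gn k.-1 * (s - 1)).
      by rewrite ler_wpM2l // ltW.
    by lra.
  have : (s - 1) * (Q + 1) <= (Q / 64) * (Q + 1).
    by apply: ler_wpM2r; [exact: ltW|have := s_le; lra].
  move: gk_ge h1 Q64; move: (gn k) (s - 1) => g t; move: Q Q1 => q q1 a b c d.
  have : 0 < q * (q + 1) by apply: mulr_gt0; lra.
  by lra.
move: ZI; rewrite in_interval => /and3P[/eqP dZ SZ _].
have ZE : \dim Z = (k + 2)%N by rewrite dZ addn2.
have kE W : W \in interval k.-2 0%VS S -> k = (\dim W + 2)%N.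
  by rewrite in_interval => /and3P[/eqP -> _ _]; rewrite hE addn2.
pose good W := [exists T in interval k.-1 W S, full T].
(* The parameter is a positive integer. If it were at most 2, [full_of_small_line_class] would make
   [W] good, so a bad [W] has parameter at least 3. *)
have param_ge W : W \in interval k.-2 0%VS S ->
    2 * (~~ good W)%:R <= weight_param x W Z 1 - 1.
  move=> WI; have := WI; rewrite in_interval => /and3P[_ _ WS].
  have [j [jE j0]] := weight_param_pos SY WS SZ (kE W WI) ZE.
  have [gW|nW] := boolP (good W); first by rewrite mulr0 jE subr_ge0 ler1n.
  have j3 : (2 < j)%N.
    rewrite ltnNge; apply: contra nW => j2; apply/exists_inP.
    apply: (full_of_small_line_class SY noU WS SZ (kE W WI) ZE jE).
    apply: (@leq_trans 64); last by rewrite -(ler_nat R).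
    by case: (j) j2 => [|[|[|]]].
  by have : 3 <= j%:R :> R; [rewrite ler_nat|rewrite jE mulr1; lra].
have k20 : (0 < k.-2)%N by rewrite hE.
have kk : k.-2.+2 = k by rewrite hE.
have kk1 : k.-2.+1 = k.-1 by rewrite hE.
have gc0E : gc 0 k.-2 k = D.
  by rewrite -{2}kk gcount_codim2 ?Q2 // !subn0 kk kk1.
have gc1E : gc 1 k.-2 k = gn k.-1 * gn k.-2 / (Q + 1).
  by rewrite -{2}kk gcount_codim2 ?Q2 // !subSS !subn0 kk1.
have sumW : \sum_(W in interval k.-2 0%VS S) (weight_param x W Z 1 - 1) =
    D * (wt x Z - 1) + Q ^+ 2 * (gn k.-1 * gn k.-2 / (Q + 1)).
  rewrite (eq_bigr (fun W => (wt x Z - 1) + Q ^+ 2 * wt x W)); last first.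
    by move=> W _; rewrite /weight_param addrAC.
  rewrite big_split /= -mulr_sumr sum_wt_interval ?sub0v ?dimv0 //.
  rewrite wt0 mulr0 add0r subr0 (xY dS) SY mulr1n mulr1 sumr_const.
  rewrite -[_ *+ #|_|]mulr_natl card_interval ?sub0v ?dimv0 // dS.
  by rewrite gc0E gc1E.
(* [D] is the number of all [W]. The excess of the parameter over 1 sums to at most [D / 8 + D], so
   at most [9 / 16] of all [W] are bad. *)
have countW : 2 * (D - \sum_(W in interval k.-2 0%VS S) (good W)%:R) <= 9 / 8 * D.
  have cW : \sum_(W in interval k.-2 0%VS S) 1 = D :> R.
    by rewrite sumr_const card_interval ?sub0v ?dimv0 // dS gc0E.
  apply: (@le_trans _ _ (\sum_(W in interval k.-2 0%VS S) (weight_param x W Z 1 - 1))).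
    rewrite -cW -sumrB mulr_sumr; apply: ler_sum => W WI.
    apply: le_trans (param_ge W WI); rewrite ler_wpM2l //.
    by case: (good W); rewrite ?subrr ?subr0.
  rewrite sumW; have : D * (wt x Z - 1) <= D * 8^-1 by rewrite ler_wpM2l // ltW.
  have : Q ^+ 2 * (gn k.-1 * gn k.-2 / (Q + 1)) <= D.
    rewrite /D mulrA ler_pM2r ?invr_gt0 // mulrCA [leRHS]mulrC ler_pM2l // gk.
    by rewrite lerDr ltW.
  by lra.
set TT := [set T in _ | _].
(* A good [W] lies in a member of [TT], and each member of [TT] contains [gn k.-1] of the [W]. *)
have countT : \sum_(W in interval k.-2 0%VS S) (good W)%:R <= #|TT|%:R * gn k.-1 :> R.
  apply: (@le_trans _ _ (\sum_(W in interval k.-2 0%VS S) \sum_(T in TT) ((W <= T)%VS)%:R)).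
    apply: ler_sum => W WI; case: (boolP (good W)) => [/exists_inP[T TI fT]|_]; last first.
      exact: sumr_ge0.
    move: TI; rewrite in_interval => /and3P[dT WT TS].
    rewrite (bigD1 T) /=; last by rewrite inE fT in_interval dT sub0v TS.
    by rewrite WT lerDl sumr_ge0.
  rewrite exchange_big /= -sum1_card natr_sum mulr_suml; apply: ler_sum => T.
  rewrite inE in_interval => /andP[/and3P[/eqP dT _ TS] _].
  have -> : 1%:R * gn k.-1 = #|interval k.-2 0%VS T|%:R.
    rewrite card_interval ?sub0v ?dimv0 // dT mul1r.
    by rewrite -[X in gc 0 _ X](_ : k.-2.+1 = _) ?gcount_hyper ?Q2 ?hE.
  rewrite -sum1_card natr_sum [leLHS]big_mkcond [leRHS]big_mkcond.
  apply: ler_sum => W _; rewrite !in_interval !sub0v; case: (\dim W == _) => //=.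
  by case: (W <= S)%VS; case: (W <= T)%VS.
rewrite -(@ler_pM2r _ (gn k.-1)) //.
have -> : gn k * gn k.-1 = (Q + 1) * D by rewrite [RHS]mulrC divfK // gt_eqF.
rewrite [4 * _]mulrC -!mulrA ler_pM2l //.
by move: countT countW D0; lra.
Qed.

Lemma full_point_of_no_full_below S : S \in Y ->
  (forall U, (S <= U)%VS -> \dim U = k.+1 -> ~~ full_below U) ->
  exists2 P, P \in points F n & full P.
Proof.
move=> SY noU.
have dS : \dim S = k by move: (subsetP Yk _ SY); rewrite in_kspaces => /eqP.
have [k_gt2|k_le2] := ltnP 2 k; last first.
  (* For [k = 2] the whole space is itself the 3-space, with [W = 0], and a full [T] is already a
     point. *)
  have k2 : k = 2 by apply/eqP; rewrite eqn_leq k_le2.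
  have kE : k = (\dim (0%VS : subspace) + 2)%N by rewrite dimv0 k2.
  have ZE : \dim ({:'rV[F]_n}%VS) = (k + 2)%N by rewrite dim_full [LHS]nE {2}k2.
  have [j [jE _]] := weight_param_pos SY (sub0v S) (subvf S) kE ZE.
  have [|T] := full_of_small_line_class SY noU (sub0v S) (subvf S) kE ZE jE.
    have := s_small; have := jE; rewrite -[X in weight_param _ _ _ X](_ : k.-1 = 1%N) ?k2 //.
    rewrite -k2 weight_param_full => -> h.
    rewrite -(ler_nat R) natrM natrX expr2; apply: le_trans h.
    by rewrite ler_wpM2r ?mulr_ge0 // ler_nat.
  rewrite in_interval k2 => /and3P[dT _ _] fT.
  by exists T; rewrite ?in_points // -k2.
apply: (full_point_of_many k_gt2 SY _ (many_full k_gt2 SY noU)) => T.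
rewrite inE in_interval => /andP[/and3P[/eqP dT _ TS] fT].
by split; rewrite // dT.
Qed.

End HalfDimension.

(** * Duality and classification *)

Section Duality.
Variables (F : finFieldType) (n : nat).
Local Notation subspace := {vspace 'rV[F]_n}.
Implicit Types (A B P S T U W Z H : subspace) (Y : {set subspace}).

(** The orthogonal complement for the standard dot product on row vectors. *)
Definition perp A : subspace := mx2vs (kermx (vs2mx A)^T).

Lemma dim_perp A : \dim (perp A) = (n - \dim A)%N.
Proof.
rewrite /dimv mx2vsK mxrank_ker mxrank_tr.
by congr (_ - _)%N; rewrite /dim /= mul1n.
Qed.

Lemma perp_anti A B : (A <= B)%VS -> (perp B <= perp A)%VS.
Proof.
rewrite /subsetv => /submxP[D AE].
rewrite !mx2vsK; apply/sub_kermxP; rewrite AE trmx_mul mulmxA mulmx_ker.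
by rewrite mul0mx.
Qed.

Lemma dim_le A : (\dim A <= n)%N.
Proof. by have := dimvS (subvf A); rewrite dim_full. Qed.

Lemma perpK : involutive perp.
Proof.
move=> A; apply/esym/eq_dim_subv.
  rewrite /subsetv mx2vsK; apply/sub_kermxP.
  have /submxP[D ->] : (vs2mx (perp A) <= kermx (vs2mx A)^T)%MS by rewrite mx2vsK.
  by rewrite -[LHS]trmxK [X in X^T]trmx_mul trmxK -mulmxA mulmx_ker mulmx0 trmx0.
by rewrite !dim_perp subKn // dim_le.
Qed.

Lemma perp_sub A B : (perp A <= perp B)%VS = (B <= A)%VS.
Proof.
apply/idP/idP; last exact: perp_anti.
by move=> /perp_anti; rewrite !perpK.
Qed.

Variable R : realFieldType.
Local Notation Q := (#|F|%:R : R).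
Local Notation gn := (gnum Q).
Local Notation Q2 := (card_field_ge2 F R).

(** The constant of the degree 1 function is absorbed into the point weights, and [s] is the total
    weight. *)
Definition is_class k (Y : {set subspace}) (s : R) : Prop :=
  Y \subset kspaces F n k /\ exists x : subspace -> R,
    (forall S, \dim S = k -> wt x S = (S \in Y)%:R) /\ wt x fullv = s.

Lemma class_card k Y s : (1 < k)%N -> (k < n)%N -> is_class k Y s ->
  #|Y|%:R = gcount Q 1 k n * s.
Proof. by move=> k1 kn [Yk [x [xY <-]]]; exact: card_class. Qed.

Lemma class_eq0 k Y s : (1 < k)%N -> (k < n)%N -> is_class k Y s ->
  (s == 0) = (Y == set0).
Proof. by move=> k1 kn [Yk [x [xY <-]]]; exact: (param_eq0 k1 kn Yk xY). Qed.

Definition dual (Y : {set subspace}) := perp @^-1: Y.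

Section Half.
Variable k : nat.
Hypotheses (k_gt1 : (1 < k)%N) (nE : n = (k + k)%N).

Let kn : (k < n)%N.
Proof. by rewrite nE -[X in (X < _)%N]addn0 ltn_add2l ltnW. Qed.

Let nk : (n - k = k)%N.
Proof. by rewrite [X in (X - _)%N]nE addnK. Qed.

Let n1 : n.-1.+1 = n.
Proof. by rewrite prednK // (leq_ltn_trans _ kn). Qed.

Lemma class_dual Y s : is_class k Y s -> is_class k (dual Y) s.
Proof.
move=> cY; have [Yk [x [xY xs]]] := cY.
have dualk : dual Y \subset kspaces F n k.
  apply/subsetP => S; rewrite inE => /(subsetP Yk); rewrite !in_kspaces dim_perp.
  by move=> /eqP dS; rewrite -(subKn (dim_le S)) dS nk.
(* Over the points [P] of [S], [wt x (perp P)] sums to [Q ^+ k.-1 * wt x (perp S) + gn k.-1 * s].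
   Spreading the second term over the [gn k] points of [S] and dividing gives these weights. *)
pose x' P := (wt x (perp P) - gn k.-1 * s / gn k) / Q ^+ k.-1.
have x'Y S : \dim S = k -> wt x' S = (S \in dual Y)%:R.
  move=> dS; have dpS : \dim (perp S) = k by rewrite dim_perp dS nk.
  have g0 : gn k != 0 by rewrite gnum_neq0 ?Q2 // ltnW.
  have P0 : Q ^+ k.-1 != 0 by rewrite lt0r_neq0 // expQ_gt0 ?Q2.
  rewrite inE -(xY _ dpS).
  have sumH : \sum_(P in points F n | (P <= S)%VS) wt x (perp P) =
      gn k * wt x (perp S) + gn k.-1 * (s - wt x (perp S)).
    transitivity (\sum_(H in interval n.-1 (perp S) fullv) wt x H).
      rewrite [RHS](reindex_inj (can_inj (@perpK)))/=; apply: eq_bigl => P.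
      rewrite in_interval in_points subvf andbT perp_sub dim_perp.
      congr andb; rewrite -subn1; have n0 : (0 < n)%N := leq_ltn_trans (leq0n k) kn.
      have aux (a b : nat) : (a <= b -> 0 < b -> (a == 1) = (b - a == b - 1))%N by lia.
      by rewrite (aux _ _ (dim_le P) n0).
    have gch w : (w <= n.-1)%N -> gcount Q w n.-1 n = gn (n - w).
      by move=> /(gcount_hyper Q2); rewrite n1.
    have kn1 : (k.+1 <= n.-1)%N.
      by rewrite -ltnS n1 [X in (_ < X)%N]nE -addn2 leq_add2l.
    rewrite sum_wt_interval ?subvf ?dpS ?dim_full // !gch ?(ltnW kn1) //.
    by rewrite subnS nk xs.
  have gk : gn k = gn k.-1 + Q ^+ k.-1.
    have -> : gn k = gn (k.-1 + 1) by rewrite addn1 prednK // ltnW.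
    by rewrite gnumD ?Q2 // gnum1 ?Q2 // mulr1.
  rewrite /wt /x' -mulr_suml sumrB sumH.
  have -> : \sum_(P in points F n | (P <= S)%VS) (gn k.-1 * s / gn k) = gn k.-1 * s.
    by rewrite -[gn k.-1 * s / gn k]mul1r -mulr_suml card_points_in dS mulrC divfK.
  by rewrite -/(wt x _) {1}gk; field; exact: P0.
split=> //; exists x'; split => //.
(* As [perp] is a bijection, the dual class has the same size and so the same parameter. *)
have := card_class k_gt1 dualk x'Y; have := class_card k_gt1 kn cY.
have -> : #|dual Y| = #|Y|.
  by rewrite on_card_preimset //; exists perp => S _; rewrite perpK.
by move=> -> /(mulfI _) ->; rewrite // lt0r_neq0 // gcount_gt0 ?Q2 // ltnW.
Qed.

(** Here [s] is the weight parameter of the interval from 0 to the whole space, hence a natural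
    number, nonzero for nonempty [Y]. *)
Lemma class_half_ge1 Y s : is_class k Y s -> Y != set0 -> 1 <= s.
Proof.
move=> cY Y0; have [Yk [x [xY xs]]] := cY.
have s0 : 0 <= s by rewrite -xs (param_ge0 k_gt1 kn Yk xY).
have kE0 : k = (\dim (0%VS : subspace) + k.-1.+1)%N.
  by rewrite dimv0 add0n prednK // ltnW.
have ZE0 : \dim ({:'rV[F]_n}%VS) = (k + k.-1.+1)%N.
  by rewrite dim_full prednK // ltnW.
have wp : weight_param x 0%VS fullv k.-1 = s.
  by rewrite /weight_param wt0 mulr0 addr0.
have [S SY] := set0Pn _ Y0.
have SI : S \in interval k 0%VS fullv.
  by rewrite in_interval sub0v subvf andbT -in_kspaces (subsetP Yk).
have := weight_param_nat k_gt1 xY (sub0v _) kE0 ZE0 SI.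
rewrite wp => /(_ s0)[j jE]; rewrite jE ler1n lt0n; apply: contra Y0 => /eqP j0.
by rewrite -(class_eq0 k_gt1 kn cY) jE j0.
Qed.

(** If some member lies below no full [U], there is a full point. Otherwise pass to the dual: a full
    space above [perp S] there would be a full [T] below [S], which [full_excl] forbids beside the
    full [V] above [S]. So the dual has a full point, that is, [Y] has a full hyperplane. *)
Lemma class_half_full Y s : is_class k Y s -> Y != set0 ->
  64 * (s * s) <= Q ->
  (exists2 P, P \in points F n & full k Y P) \/
  (exists2 H, H \in hyperplanes F n & full_below k Y H).
Proof.
move=> cY Y0 s_small.
have s1 := class_half_ge1 cY Y0.
have [Yk [x [xY xs]]] := cY.
rewrite -xs in s1 s_small.
pose hasU S := [exists U, [&& (S <= U)%VS, \dim U == k.+1 & full_below k Y U]].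
have [/exists_inP[S SY noU]|allU] := boolP [exists S in Y, ~~ hasU S].
  left; apply: (full_point_of_no_full_below k_gt1 xY nE Yk s1 s_small SY) => U SU dU.
  by apply: contra noU => fU; apply/existsP; exists U; rewrite SU dU eqxx.
right; have [S SY] := set0Pn _ Y0.
have [Y'k [x' [x'Y x's]]] := class_dual cY.
have dS : \dim S = k by move: (subsetP Yk _ SY); rewrite in_kspaces => /eqP.
have S'Y : perp S \in dual Y by rewrite inE perpK.
have : exists2 P, P \in points F n & full k (dual Y) P.
  rewrite xs -x's in s1 s_small.
  apply: (full_point_of_no_full_below k_gt1 x'Y nE Y'k s1 s_small S'Y) => U SU dU.
  apply/negP => fU.
  move: allU => /exists_inPn/(_ S SY); rewrite negbK => /existsP[V /and3P[SV /eqP dV fV]].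
  have TS : (perp U <= S)%VS by rewrite -[S]perpK perp_sub.
  have dT : (\dim (perp U)).+1 = k.
    by rewrite dim_perp dU subnS nk prednK // ltnW.
  rewrite x's -xs in s1 s_small.
  apply: (full_excl k_gt1 xY nE s1 s_small (subv_trans TS SV) dT dV _ fV).
  apply/fullP => A dA UA.
  have : perp A \in dual Y.
    apply: (subsetP fU); rewrite in_interval sub0v -[U]perpK perp_sub UA.
    by rewrite dim_perp dA nk eqxx.
  by rewrite inE perpK.
move=> [P Pp fP]; exists (perp P).
  rewrite inE dim_perp; move: Pp; rewrite in_points => /eqP->.
  by rewrite subn1 n1.
apply/subsetP => A; rewrite in_interval => /and3P[/eqP dA _ AP].
have : perp A \in dual Y.
  by apply: (elimT (fullP _ _ _) fP); rewrite ?dim_perp ?dA ?nk // -[P]perpK perp_sub.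
by rewrite inE perpK.
Qed.

End Half.

(** * Removing full points and hyperplanes *)

Lemma in_through k P S :
  (S \in kspaces_through k P) = (\dim S == k) && (P <= S)%VS.
Proof. by rewrite inE in_kspaces. Qed.

Lemma in_kspaces_in k H S :
  (S \in kspaces_in k H) = (\dim S == k) && (S <= H)%VS.
Proof. by rewrite inE in_kspaces. Qed.

(** Lowering the weight of [P] by 1 lowers exactly the weights of the subspaces through [P]. *)
Lemma class_del_point k Y s P : is_class k Y s -> P \in points F n ->
  full k Y P -> is_class k (Y :\: kspaces_through k P) (s - 1).
Proof.
move=> [Yk [x [xY xs]]] Pp /fullP fP; split.
  by apply: subset_trans Yk; exact: subsetDl.
have wtE S : wt (fun T => x T - (T == P)%:R) S = wt x S - (P <= S)%VS%:R.
  rewrite /wt sumrB; congr (_ - _).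
  have [PS|PS] := boolP (P <= S)%VS.
    rewrite (bigD1 P) ?Pp //= eqxx big1 ?addr0 // => T /andP[_ /negbTE->].
    by [].
  rewrite big1 // => T /andP[_ TS]; case: eqP => // E; by rewrite -E TS in PS.
exists (fun T => x T - (T == P)%:R); split; last by rewrite wtE xs subvf.
move=> S dS; rewrite wtE xY // in_setD in_through dS eqxx /=.
have [PS|PS] := boolP (P <= S)%VS; last by rewrite subr0.
by rewrite fP // subrr.
Qed.

(** A full hyperplane is a full point of the dual class: remove that point and dualise back. *)
Lemma class_del_hyperplane k Y s H : (1 < k)%N -> n = (k + k)%N ->
  is_class k Y s -> H \in hyperplanes F n -> full_below k Y H ->
  is_class k (Y :\: kspaces_in k H) (s - 1).
Proof.
move=> k_gt1 nE cY; rewrite inE => /eqP dH /subsetP fH.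
have nk : (n - k = k)%N by rewrite [X in (X - _)%N]nE addnK.
have Pp : perp H \in points F n.
  by rewrite in_points dim_perp -{1}dH subSn // subnn.
have fP : full k (dual Y) (perp H).
  apply/fullP => S dS HS; rewrite inE; apply: fH.
  by rewrite in_interval sub0v dim_perp dS nk eqxx -[H]perpK perp_sub.
have := class_dual k_gt1 nE (class_del_point (class_dual k_gt1 nE cY) Pp fP).
rewrite (_ : dual _ = Y :\: kspaces_in k H) //.
apply/setP => S; rewrite inE in_setD in_through inE perpK perp_sub.
rewrite in_setD in_kspaces_in; case: (boolP (S \in Y)) => [SY|]; last by rewrite !andbF.
have [Yk _] := cY; have := subsetP Yk _ SY; rewrite in_kspaces => /eqP dS.
by rewrite dim_perp dS nk.
Qed.

Lemma exists_kspace k A B : (A <= B)%VS -> (\dim A <= k <= \dim B)%N ->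
  exists S, [/\ \dim S = k, (A <= S)%VS & (S <= B)%VS].
Proof.
move=> AB /(interval_neq0 R AB)[S]; rewrite in_interval => /and3P[/eqP dS AS SB].
by exists S.
Qed.

Lemma full_subset k Y Y1 P : Y \subset Y1 -> full k Y P -> full k Y1 P.
Proof. by move=> YY1 fP; apply: subset_trans YY1. Qed.

(** Some k-space contains both points, since they span at most a plane of dimension 2; it was
    removed with [P]. *)
Lemma full_point_uniq k Y P P' : (1 < k)%N -> (k < n)%N ->
  P \in points F n -> P' \in points F n ->
  ~ full k (Y :\: kspaces_through k P) P'.
Proof.
rewrite !in_points => k1 kn /eqP dP /eqP dP' /fullP fP'.
have [|S [dS PS _]] := @exists_kspace k (P + P') fullv (subvf _).
  rewrite dim_full (ltnW kn) andbT (leq_trans _ k1) //.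
  by have := dimv_add_leqif P P'; rewrite dP dP' => -[].
move: PS; rewrite subv_add => /andP[PS P'S].
by have := fP' S dS P'S; rewrite in_setD in_through dS eqxx PS.
Qed.

(** [H :&: H'] has dimension at least [n - 2 >= k], so it contains a k-space, which was removed with
    [H]. *)
Lemma full_hyperplane_uniq k Y H H' : (1 < k)%N -> n = (k + k)%N ->
  H \in hyperplanes F n -> H' \in hyperplanes F n ->
  ~ full_below k (Y :\: kspaces_in k H) H'.
Proof.
move=> k1 nE; rewrite !inE => /eqP dH /eqP dH' /subsetP fH'.
have [|S [dS _]] := @exists_kspace k 0%VS (H :&: H') (sub0v _).
  rewrite dimv0 /=; have := dimv_sum_cap H H'; have := dim_le (H + H').
  have : (k + k = n)%N by [].
  move: dH dH' k1; clear; move: (\dim (H :&: H')) (\dim (H + H')) (\dim H) (\dim H').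
  by lia.
rewrite subv_cap => /andP[SH SH'].
have := fH' S; rewrite in_interval dS eqxx sub0v SH' => /(_ isT).
by rewrite in_setD in_kspaces_in dS eqxx SH.
Qed.

Lemma full_point_hyperplane k Y P H : (0 < k)%N -> (k < n)%N ->
  P \in points F n -> H \in hyperplanes F n ->
  full_below k (Y :\: kspaces_through k P) H -> ~~ (P <= H)%VS.
Proof.
rewrite in_points inE => k0 kn /eqP dP /eqP dH /subsetP fH; apply/negP => PH.
have [|S [dS PS SH]] := @exists_kspace k P H PH; first by rewrite dP k0 -ltnS dH.
have := fH S; rewrite in_interval dS eqxx sub0v SH => /(_ isT).
by rewrite in_setD in_through dS eqxx PS.
Qed.

Lemma through_subset k Y P : full k Y P -> kspaces_through k P \subset Y.
Proof.
move=> /fullP fP; apply/subsetP => S; rewrite in_through => /andP[/eqP dS PS].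
exact: fP.
Qed.

Lemma kspaces_in_subset k Y H : full_below k Y H -> kspaces_in k H \subset Y.
Proof.
move=> /subsetP fH; apply/subsetP => S; rewrite in_kspaces_in => /andP[dS SH].
by apply: fH; rewrite in_interval dS sub0v.
Qed.

Lemma eq_of_setD0 (A B : {set subspace}) : B \subset A -> A :\: B = set0 -> A = B.
Proof.
by move=> BA /eqP; rewrite setD_eq0 => AB; apply/eqP; rewrite eqEsubset AB.
Qed.

Lemma class_trivial_half k Y s : (1 < k)%N -> n = (k + k)%N ->
  is_class k Y s -> (1 <= s -> 64 * (s * s) <= Q) -> s <= 2 /\ basic_trivial k Y.
Proof.
move=> k1 nE cY small.
have kn : (k < n)%N by rewrite nE -[X in (X < _)%N]addn0 ltn_add2l ltnW.
have Y0s Y1 s1 : is_class k Y1 s1 -> Y1 = set0 -> s1 = 0.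
  by move=> c1 /eqP; rewrite -(class_eq0 k1 kn c1) => /eqP.
have [Y0|Y0] := eqVneq Y set0.
  by split; [rewrite (Y0s _ _ cY Y0)|constructor 1].
have s_ge1 := class_half_ge1 k1 nE cY Y0.
have small' t : 0 <= t -> t <= s -> 64 * (t * t) <= Q.
  move=> t0 ts; apply: le_trans (small s_ge1); rewrite ler_wpM2l //.
  by rewrite ler_pM.
(* Stated separately because it also covers the case in which the full hyperplane is found before
   the point: a point full after a removal was full in [Y]. *)
have caseP P : P \in points F n -> full k Y P -> s <= 2 /\ basic_trivial k Y.
  move=> Pp fP; have c1 := class_del_point cY Pp fP.
  have PY := through_subset fP.
  set Y1 := Y :\: kspaces_through k P in c1 *.
  have [Y10|Y10] := eqVneq Y1 set0.
    split; first by have := Y0s _ _ c1 Y10; lra.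
    by constructor 2; exists P => //; exact: eq_of_setD0.
  have s1_ge1 := class_half_ge1 k1 nE c1 Y10.
  have small_c1 : 64 * ((s - 1) * (s - 1)) <= Q by apply: small'; lra.
  have [[P' P'p fP']|[H Hh fH]] := class_half_full k1 nE c1 Y10 small_c1.
    by case: (full_point_uniq k1 kn Pp P'p fP').
  have PH := full_point_hyperplane (ltnW k1) kn Pp Hh fH.
  have c2 := class_del_hyperplane k1 nE c1 Hh fH.
  have HY1 := kspaces_in_subset fH.
  set Y2 := Y1 :\: kspaces_in k H in c2 *.
  have [Y20|Y20] := eqVneq Y2 set0.
    split; first by have := Y0s _ _ c2 Y20; lra.
    constructor 4; exists P, H; split => //.
    rewrite -(eq_of_setD0 HY1 Y20); apply/setP => S; rewrite in_setU in_setD.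
    by have [SP|] := boolP (S \in kspaces_through k P); first exact: subsetP PY S SP.
  have s2_ge1 := class_half_ge1 k1 nE c2 Y20.
  have small_c2 : 64 * ((s - 1 - 1) * (s - 1 - 1)) <= Q by apply: small'; lra.
  have [[P' P'p fP']|[H' H'h fH']] := class_half_full k1 nE c2 Y20 small_c2.
    by case: (full_point_uniq k1 kn Pp P'p (full_subset (subsetDl _ _) fP')).
  by case: (full_hyperplane_uniq k1 nE Hh H'h fH').
have [[P Pp fP]|[H Hh fH]] := class_half_full k1 nE cY Y0 (small s_ge1).
  exact: caseP Pp fP.
have c1 := class_del_hyperplane k1 nE cY Hh fH.
have HY := kspaces_in_subset fH.
set Y1 := Y :\: kspaces_in k H in c1 *.
have [Y10|Y10] := eqVneq Y1 set0.
  split; first by have := Y0s _ _ c1 Y10; lra.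
  by constructor 3; exists H => //; exact: eq_of_setD0.
have s1_ge1 := class_half_ge1 k1 nE c1 Y10.
have small_c1 : 64 * ((s - 1) * (s - 1)) <= Q by apply: small'; lra.
have [[P Pp fP]|[H' H'h fH']] := class_half_full k1 nE c1 Y10 small_c1.
  exact: caseP P Pp (full_subset (subsetDl _ _) fP).
by case: (full_hyperplane_uniq k1 nE Hh H'h fH').
Qed.

(** A member of a nonempty class is itself a full subspace, from which [full_point_of_full] descends
    to a full point. After its removal the class must be empty, as a second full point is
    impossible. *)
Lemma class_trivial_large k Y s : (1 < k)%N -> (2 * k < n)%N ->
  is_class k Y s -> 16 * s <= Q ^+ (n - 2 * k) -> s <= 2 /\ basic_trivial k Y.
Proof.
move=> k1 kn2 cY small.
have kn : (k < n)%N by apply: leq_ltn_trans kn2; rewrite leq_pmull.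
have Y0s Y1 s1 : is_class k Y1 s1 -> Y1 = set0 -> s1 = 0.
  by move=> c1 /eqP; rewrite -(class_eq0 k1 kn c1) => /eqP.
have [Y0|Y0] := eqVneq Y set0.
  by split; [rewrite (Y0s _ _ cY Y0)|constructor 1].
have fullpoint Y1 s1 : is_class k Y1 s1 -> s1 <= s -> Y1 != set0 ->
    exists2 P, P \in points F n & full k Y1 P.
  move=> [Yk [x [xY xs]]] s1s /set0Pn[S SY].
  have dS : \dim S = k by move: (subsetP Yk _ SY); rewrite in_kspaces => /eqP.
  apply: (@full_point_of_full R F n x k Y1 k1 kn Yk xY S _ (ltnW kn2)).
  - by rewrite xs; lra.
  - by rewrite dS leqnn (ltnW k1).
  by apply/fullP => T dT ST; rewrite -(eq_dim_subv ST) ?dS ?dT.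
have [P Pp fP] := fullpoint _ _ cY (lexx s) Y0.
have c1 := class_del_point cY Pp fP.
have [Y10|Y10] := eqVneq (Y :\: kspaces_through k P) set0.
  split; first by have := Y0s _ _ c1 Y10; lra.
  by constructor 2; exists P => //; exact: eq_of_setD0 (through_subset fP) Y10.
have [|P' P'p fP'] := fullpoint _ _ c1 _ Y10; first lra.
by case: (full_point_uniq k1 kn Pp P'p fP').
Qed.

End Duality.

(** * From the stated definitions to weighted classes *)

Lemma qint_nat (R : realFieldType) (q a : nat) : qint R q a%:Z = gnum q%:R a.
Proof. by []. Qed.

Lemma qbinom_gcount (R : realFieldType) (q n k : nat) : (0 < k)%N -> (k <= n)%N ->
  qbinom R q (n%:Z - 1) (k%:Z - 1) = gcount q%:R 1 k n.
Proof.
case: k => // k _ kn; rewrite -[k.+1]addn1 PoszD addrK /qbinom /gcount addn1.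
rewrite big_add1 big_mkord; apply: eq_bigr => i _.
have ilt := ltn_ord i; have iltn : (i.+1 <= n)%N by apply: leq_trans kn; exact: ltnW.
rewrite -2!qint_nat subSS; congr (qint _ _ _ / qint _ _ _).
  by rewrite -addrA -opprD -PoszD add1n subzn.
by rewrite subzn // ltnW.
Qed.

(** Every k-space has [gnum #|F|%:R k] points, so the constant [c0] can be shared equally among
    them. *)
Lemma class_of_Cameron_Liebler (R : realFieldType) (F : finFieldType) (n k : nat)
    (Y : {set {vspace 'rV[F]_n}}) : (0 < k)%N ->
  Cameron_Liebler R k Y -> exists s : R, is_class k Y s.
Proof.
move=> k0 [Yk [c0 [c fE]]].
pose x P := c P + c0 / gnum #|F|%:R k.
exists (wt x fullv); split => //; exists x; split => // S dS.
rewrite fE ?in_kspaces ?dS // /wt big_split /= addrC; congr (_ + _).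
  rewrite -[c0 / _]mul1r -mulr_suml card_points_in dS mulrC divfK //.
  by rewrite gnum_neq0 // card_field_ge2.
rewrite [LHS]big_mkcondr /=; apply: eq_bigr => P _.
by case: (P <= S)%VS; rewrite ?mulr1 ?mulr0.
Qed.

Theorem theorem1p7 (R : realType) (F : finFieldType) (q n k m r : nat)
    (l : int) (s : R) (Y : {set {vspace 'rV[F]_n}})
    (hq : #|F| = q)
    (hk : (1 < k)%N)
    (hn : (2 * k <= n)%N)
    (hnmr : n%:Z = m%:Z * k%:Z - r%:Z)
    (hr : (r < k)%N)
    (hY : Cameron_Liebler R k Y)
    (hsize : #|Y|%:R = s * qbinom R q (n%:Z - 1) (k%:Z - 1))
    (hl : qint R q (l - 1) < s <= qint R q l)
    (hs : 16%:R * s <=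
      Num.min (q%:R `^ ((n%:R - k%:R - l%:~R + 2%:R) / 3%:R))
              (q%:R `^ ((n%:R - 2%:R * k%:R - r%:R + 1) / 3%:R))) :
  s <= 2%:R /\ trivial_class k Y.
Proof.
have Q2 := card_field_ge2 F R; rewrite hq in Q2.
have kn : (k < n)%N.
  by apply: leq_trans hn; rewrite mul2n -addnn -[X in (X < _)%N]addn0 ltn_add2l ltnW.
have [s0 cY] := class_of_Cameron_Liebler (ltnW hk) hY.
have gc0 : gcount q%:R 1 k n != 0 :> R by rewrite lt0r_neq0 // gcount_gt0 // ltnW.
(* The size of [Y] determines the parameter, so the total weight is the given [s]. *)
have sE : s0 = s.
  apply: (mulfI gc0); have := class_card hk kn cY; rewrite hq => <-.
  by rewrite hsize qbinom_gcount 1?mulrC // ltnW.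
rewrite sE in cY.
have q1 : (1 : R) <= q%:R by apply: le_trans Q2; rewrite ler1n.
(* The second term of the minimum, weakened to any larger exponent. *)
have hs' (e : R) : (n%:R - 2%:R * k%:R - r%:R + 1) / 3%:R <= e ->
    16 * s <= q%:R `^ e.
  move=> le_e; apply: le_trans hs _; apply: le_trans (ler_powR q1 le_e).
  by rewrite ge_min lexx orbT.
have r0 : (0 : R) <= r%:R by [].
suff [s2 bY] : s <= 2%:R /\ basic_trivial k Y by split => //; left.
move: hn; rewrite leq_eqVlt => /orP[/eqP nE|kn2].
  apply: (class_trivial_half hk _ cY); first by rewrite -nE mul2n addnn.
  move=> s1; rewrite hq; have : 16 * s <= q%:R `^ 3^-1.
    by apply: hs'; rewrite -nE natrM; lra.
  have s0' : 0 <= 16 * s by lra.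
  (* For [n = 2k] the exponent is at most one third. Cubing gives [4096 s^3 <= q], which for
     [s >= 1] implies [64 s^2 <= q]. *)
  move=> h; have : (16 * s) ^+ 3 <= q%:R.
    have -> : (q%:R : R) = (q%:R `^ 3^-1) ^+ 3.
      by rewrite -powR_mulrn ?powR_ge0 // -powRrM mulVf ?pnatr_eq0 // powRr1.
    by apply: lerXn2r; rewrite ?nnegrE ?powR_ge0.
  have -> : (16 * s) ^+ 3 = 4096 * (s * (s * s)) by ring.
  have ss0 : 0 <= s * s by rewrite mulr_ge0 //; lra.
  have : 1 * (s * s) <= s * (s * s) by rewrite ler_wpM2r.
  by lra.
apply: (class_trivial_large hk kn2 cY); rewrite hq -powR_mulrn // hs' //.
have kn2' : (2 * k <= n)%N := ltnW kn2.
(* With [t = n - 2k >= 1], the exponent is at most [(t + 1) / 3], hence at most [t]. *)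
rewrite natrB // natrM; have : (1 : R) <= n%:R - 2 * k%:R.
  by rewrite -natrM -natrB // ler1n subn_gt0.
by lra.
Qed.
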